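(* Let $m\in\mathbb{Z}^+$, let $X$ be a compact Hausdorff space and let $A$ be a unital $(\mathbb{Z}/2^m)$-$C(X)$-algebra with fibers $A_x$, $x\in X$. Then the function $$X\ni x\longmapsto\dim^{\mathbb{Z}/2^m}_{\mathrm{WLT}}(A_x)\in\mathbb{Z}_{\ge0}\sqcup\{\infty\}$$ is upper semicontinuous.
   Context: A unital $C(X)$-algebra ($X$ compact Hausdorff) is a unital $C^*$-algebra $A$ with a unital $*$-homomorphism $C(X)\to Z(A)$ into its center (the field is not assumed continuous). A $\mathbb{G}$-$C(X)$-algebra is a $C(X)$-algebra with an action of the group $\mathbb{G}$ by $*$-automorphisms fixing the structure morphism $C(X)\to Z(A)$ (i.e. fixing its image pointwise). The fiber at $x$ is $A_x:=A/J_x$, where $J_x$ is the closed ideal generated by (the image of) $\{f\in C(X): f(x)=0\}$; it inherits a $\mathbb{G}$-action. Weak local-triviality dimension: for an action of $\mathbb{Z}/k$ on a unital $C^*$-algebra $B$, $\dim^{\mathbb{Z}/k}_{\mathrm{WLT}}(B)$ is the infimum ($\infty$ if there is none) of the $n\in\mathbb{N}=\{0,1,\dots\}$ for which there exist $\mathbb{Z}/k$-equivariant $*$-homomorphisms $\rho_0,\dots,\rho_n:C_0((0,1])\otimes C(\mathbb{Z}/k)\to B$ (translation action on $C(\mathbb{Z}/k)$) with $\sum_{j}\rho_j(t\otimes1)$ invertible, where $t$ is the identity function in $C_0((0,1])$. Equivalently, it is the infimum of the $n$ for which there are normal elements $a_0,\dots,a_n\in B_\gamma$ with spectra in $\{s\,e^{2\pi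 i l/k}: s\in[0,1],\,0\le l\le k-1\}$ and $\sum_i a_ia_i^*$ invertible, where $\gamma$ is a generator of $\widehat{\mathbb{Z}/k}$ and $B_\gamma=\{b\in B: g\cdot b=\gamma(g)b\ \forall g\in\mathbb{Z}/k\}$. Upper semicontinuity means: for every $n\in\mathbb{Z}_{\ge0}$ the set $\{x\in X:\dim^{\mathbb{Z}/2^m}_{\mathrm{WLT}}(A_x)\le n\}$ is open in $X$. *)

(* Defs.v *)
From HB Require Import structures.
From mathcomp Require Import all_boot all_order all_algebra.
From mathcomp Require Import complex ring lra.
From mathcomp Require Import all_classical all_reals all_analysis.

Set Implicit Arguments.
Unset Strict Implicit.
Unset Printing Implicit Defensive.

Import Order.TTheory GRing.Theory Num.Theory.
Import numFieldNormedType.Exports.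

Local Open Scope classical_set_scope.
Local Open Scope ring_scope.
Local Open Scope quotient_scope.

HB.instance Definition _ (R : realType) := NormedModule.copy R[i] (R[i]^o : Type).

(* The scalar field is R[i], so the norm takes its values in R[i] (they are
   nonnegative reals there).  The zero algebra is allowed (1 = 0), since fibers
   of a C(X)-algebra may vanish; MathComp's algType would exclude it.
   Multiplication is a field of the mixin, because Hierarchy Builder does not
   accept a join of normed modules and rings outside of numDomainType; the
   PzRing instance below recovers the usual ring notations and theory. *)
HB.mixin Record isCstarAlgebra (R : realType) A
    & CompleteNormedModule R[i] A := {
  cstar_one : A;
  cstar_mul : A -> A -> A;
  star : A -> A;
  cstar_mulA : associative cstar_mul;
  cstar_mul1r : left_id cstar_one cstar_mul;
  cstar_mulr1 : right_id cstar_one cstar_mul;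
  cstar_mulDl : left_distributive cstar_mul +%R;
  cstar_mulDr : right_distributive cstar_mul +%R;
  cstar_scaleAl : forall (c : R[i]) (a b : A),
    c *: cstar_mul a b = cstar_mul (c *: a) b;
  cstar_scaleAr : forall (c : R[i]) (a b : A),
    c *: cstar_mul a b = cstar_mul a (c *: b);
  starK : involutive star;
  starD : {morph star : a b / a + b};
  starZ : forall (c : R[i]) (a : A), star (c *: a) = c^* *: star a;
  starM : forall a b : A, star (cstar_mul a b) = cstar_mul (star b) (star a);
  cstar_normM : forall a b : A, `|cstar_mul a b| <= `|a| * `|b|;
  cstar_norm : forall a : A, `|cstar_mul (star a) a| = `|a| ^+ 2
}.

#[short(type="cstarAlgType")]
HB.structure Definition CstarAlgebra (R : realType) :=
  {A of CompleteNormedModule R[i] A & isCstarAlgebra R A}.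

HB.instance Definition _ (R : realType) (A : cstarAlgType R) :=
  GRing.Zmodule_isPzRing.Build A (@cstar_mulA R A) (@cstar_mul1r R A)
    (@cstar_mulr1 R A) (@cstar_mulDl R A) (@cstar_mulDr R A).

Section Homomorphisms.
Variable R : realType.

(* Not necessarily unital *-homomorphism into B from the *-algebra D of
   complex functions on T with pointwise operations.  Only the restriction of
   rho to D is meaningful. *)
Definition fun_star_hom (T : Type) (D : set (T -> R[i])) (B : cstarAlgType R)
    (rho : (T -> R[i]) -> B) : Prop :=
  [/\ forall (c : R[i]) f g, D f -> D g ->
        rho (fun t => c * f t + g t) = c *: rho f + rho g,
      forall f g, D f -> D g -> rho (fun t => f t * g t) = rho f * rho g
    & forall f, D f -> rho (fun t => (f t)^*) = star (rho f)].

Definition star_hom (A B : cstarAlgType R) (f : A -> B) : Prop :=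
  [/\ linear f, monoid_morphism f & forall a, f (star a) = star (f a)].

(* G is written additively; the automorphism property of each [act g] follows
   from the action laws. *)
Record cstar_action (G : zmodType) (A : cstarAlgType R) := CstarAction {
  act :> G -> A -> A;
  act_hom : forall g, star_hom (act g);
  act0 : forall a, act 0 a = a;
  actD : forall g h a, act (g + h) a = act g (act h a)
}.

End Homomorphisms.

Record CX_structure (R : realType) (X : topologicalType) (A : cstarAlgType R) :=
  CXStructure {
  cx :> (X -> R[i]) -> A;
  cx_hom : fun_star_hom [set f : X -> R[i] | continuous f] cx;
  cx1 : cx (fun=> 1) = 1;
  cx_central : forall (f : X -> R[i]) (a : A),
    continuous f -> cx f * a = a * cx f
}.

Record equivariant_CX_structure (R : realType) (G : zmodType)
    (X : topologicalType) (A : cstarAlgType R) := EquivariantCXStructure {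
  cx_of :> CX_structure X A;
  cx_act : cstar_action G A;
  cx_act_fix : forall (g : G) (f : X -> R[i]),
    continuous f -> cx_act g (cx_of f) = cx_of f
}.

Section Fiber.
Variables (R : realType) (X : topologicalType) (A : cstarAlgType R).

Definition closed_ideal (I : set A) : Prop :=
  [/\ closed I, I 0, forall a b, I a -> I b -> I (a + b)
    & forall a b, I b -> I (a * b) /\ I (b * a)].

Variables (phi : CX_structure X A) (x : X).

Definition fiber_ideal : set A :=
  smallest closed_ideal
    [set phi f | f in [set f : X -> R[i] | continuous f /\ f x = 0]].

Lemma fiber_ideal_closed : closed_ideal fiber_ideal.
Proof.
split.
- by apply: closed_bigI => I [[]].
- by move=> I [[]].
- by move=> a b Ja Jb I II; case: (II) => -[_ _ D _] _; exact: D (Ja _ II) (Jb _ II).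
- by move=> a b Jb; split=> I II; case: (II) => -[_ _ _ M] _; case: (M a b (Jb _ II)).
Qed.

Lemma fiber_ideal_cx f : continuous f -> f x = 0 -> fiber_ideal (phi f).
Proof. by move=> cf f0 I [_]; apply; exists f. Qed.

Lemma fiber_ideal_zmod_closed : zmod_closed (mem fiber_ideal).
Proof.
have [_ J0 JD JM] := fiber_ideal_closed.
split=> [|a b]; rewrite !inE// => Ja Jb; apply: JD => //.
by rewrite -mulN1r; apply (JM _ _ Jb).
Qed.

Definition fiber_pred : {pred A} := mem fiber_ideal.
HB.instance Definition _ :=
  GRing.isZmodClosed.Build A fiber_pred fiber_ideal_zmod_closed.

(* The quotient A / J_x; its norm is [fiber_norm] below. *)
Definition fiber : Type := Quotient.quot fiber_pred.
HB.instance Definition _ := GRing.Zmodule.on fiber.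

Definition fiber_pi (a : A) : fiber := \pi_(Quotient.quot fiber_pred) a.
Definition fiber_repr (u : fiber) : A := repr (u : Quotient.quot fiber_pred).

Lemma fiber_reprK u : fiber_pi (fiber_repr u) = u.
Proof. exact: (@reprK _ (Quotient.quot fiber_pred)). Qed.

Lemma fiber_piP a b : fiber_pi a = fiber_pi b <-> fiber_ideal (a - b).
Proof.
have e := Quotient.idealrBE fiber_pred a b.
split=> [/eqP|]; first by rewrite /fiber_pi -e => /set_mem.
by move=> /mem_set h; apply/eqP; rewrite /fiber_pi -e.
Qed.

Lemma fiber_piD : {morph fiber_pi : a b / a + b}.
Proof. exact: Quotient.pi_add. Qed.

Lemma fiber_pi0 : fiber_pi 0 = 0.
Proof. by rewrite /fiber_pi !piE. Qed.

Lemma fiber_piN : {morph fiber_pi : a / - a}.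
Proof. exact: Quotient.pi_opp. Qed.
End Fiber.

Section CstarFacts.
Variables (R : realType) (A : cstarAlgType R).
Implicit Types (a b : A) (c : R[i]).

Lemma cscalerAl c a b : c *: (a * b) = (c *: a) * b.
Proof. exact: cstar_scaleAl. Qed.

Lemma cscalerAr c a b : c *: (a * b) = a * (c *: b).
Proof. exact: cstar_scaleAr. Qed.

Lemma starMr a b : star (a * b) = star b * star a.
Proof. exact: starM. Qed.

Lemma ler_cnormM a b : `|a * b| <= `|a| * `|b|.
Proof. exact: cstar_normM. Qed.

Lemma normr_star_mul a : `|star a * a| = `|a| ^+ 2.
Proof. exact: cstar_norm. Qed.

Lemma star1 : star 1 = 1 :> A.
Proof.
have h : star (star 1 * 1) = star 1 :> A by rewrite starMr starK mulr1.
by rewrite mulr1 starK in h.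
Qed.

Lemma starN : {morph (@star R A) : a / - a}.
Proof. by move=> a; rewrite -(scaleN1r a) starZ rmorphN rmorph1 scaleN1r. Qed.

Lemma ler_cnorm1 : `|1 : A| <= 1.
Proof.
have := normr_star_mul 1; rewrite star1 mulr1 => h.
have [->//|n0] := eqVneq (`|1 : A|) 0.
suff -> : `|1 : A| = 1 by [].
by apply: (mulIf n0); rewrite mul1r -expr2 -h.
Qed.

Lemma normr_star a : `|star a| = `|a|.
Proof.
have le a' : `|a'| <= `|star a'|.
  have [->//|n0] := eqVneq (`|a'|) 0.
  have p0 : 0 < `|a'| by rewrite lt_def n0 normr_ge0.
  by rewrite -(ler_pM2r p0) -expr2 -normr_star_mul ler_cnormM.
by apply/eqP; rewrite eq_le le -{2}(starK a) le.
Qed.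

Definition nrm a : R := complex.Re `|a|.

Lemma nrmE a : `|a| = (nrm a)%:C%C.
Proof.
have := normr_ge0 a; rewrite /nrm.
by case: `|a| => r s; rewrite lecE /= => /andP[/eqP -> _].
Qed.

Lemma nrm_ge0 a : 0 <= nrm a.
Proof. by rewrite -ler0c -nrmE. Qed.

End CstarFacts.

Lemma conjC_continuous (R : realType) (X : topologicalType) (f : X -> R[i]) :
  continuous f -> continuous (fun y => (f y)^*).
Proof.
move=> cf y; apply/cvgrPdist_lt => e e0.
move/cvgrPdist_lt : (cf y) => /(_ e e0); apply: filterS => z.
by rewrite -rmorphB norm_conjC.
Qed.

Lemma cayley_fieldE (F : numFieldType) (p q : F) : p != 0 -> q != 0 ->
  [/\ p / q * (q / p) = 1, q / p * (p / q) = 1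
    & 4^-1 * (2 * 1 + (p / q + q / p)) * (4^-1 * (2 * 1 + (p / q + q / p))) *
        (- ((p - q) / 2) ^+ 2) =
      - ((p + q) / 2) ^+ 2 *
        (4^-1 * (p / q + (-1) * (q / p)) * (4^-1 * (p / q + (-1) * (q / p))))].
Proof. by move=> p0 q0; split; field; rewrite p0 q0. Qed.

Lemma midpointE (F : numFieldType) (t s : F) :
  (t + s + (t - s)) / 2 = t /\ (t + s - (t - s)) / 2 = s.
Proof. by split; field. Qed.

Lemma four_quarters (F : numFieldType) : 4^-1 * (2 * 1 + (1 + 1)) = 1 :> F.
Proof. by field. Qed.

Lemma sumr_ones (F : numFieldType) : (2 * 1 + (1 + 1) <= 4 :> F) * (1 + 1 <= 4 :> F).
Proof. by rewrite mulr1 -!(natrD _ 1 1) -natrD !ler_nat. Qed.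

Section CXFacts.
Variables (R : realType) (X : topologicalType) (A : cstarAlgType R).
Variable phi : CX_structure X A.
Implicit Types f g : X -> R[i].

Lemma cxM f g : continuous f -> continuous g ->
  phi (fun y => f y * g y) = phi f * phi g.
Proof. by case: (cx_hom phi) => _ h _; exact: h. Qed.

Lemma cxJ f : continuous f -> phi (fun y => (f y)^*) = star (phi f).
Proof. by case: (cx_hom phi) => _ _ h; exact: h. Qed.

Lemma cx_lin c f g : continuous f -> continuous g ->
  phi (fun y => c * f y + g y) = c *: phi f + phi g.
Proof. by case: (cx_hom phi) => h _ _; exact: h. Qed.

Lemma cx0 : phi (fun=> 0) = 0.
Proof.
have c0 : continuous (fun _ : X => 0 : R[i]) by move=> y; exact: cvg_cst.
have := @cx_lin 1 _ _ c0 c0.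
rewrite scale1r (_ : (fun y => _) = fun=> 0); last first.
  by apply/funext => y; rewrite mulr0 addr0.
by move/(congr1 (fun z => z - phi (fun=> 0))); rewrite subrr addrK => <-.
Qed.

Lemma cxZ c f : continuous f -> phi (fun y => c * f y) = c *: phi f.
Proof.
move=> cf; have c0 : continuous (fun _ : X => 0 : R[i]) by move=> y; exact: cvg_cst.
have := cx_lin c cf c0; rewrite cx0 addr0 => <-; congr (phi _).
by apply/funext => y; rewrite addr0.
Qed.

Lemma cxD f g : continuous f -> continuous g ->
  phi (fun y => f y + g y) = phi f + phi g.
Proof.
move=> cf cg; rewrite -[phi f]scale1r -cx_lin//; congr (phi _).
by apply/funext => y; rewrite mul1r.
Qed.

Lemma cx_unitary f : continuous f -> (forall y, (f y)^* * f y = 1) ->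
  `|phi f| <= 1.
Proof.
move=> cf f1; rewrite -(@ler_pXn2r _ 2) ?nnegrE// -normr_star_mul -(cxJ cf).
rewrite -(cxM (conjC_continuous cf) cf).
rewrite (_ : (fun y => _) = fun=> 1); last exact/funext.
by rewrite cx1 expr1n ler_cnorm1.
Qed.

Lemma cx_approx_unit (x : X) f (t : R[i]) : continuous f -> f x = 0 -> 0 < t ->
  exists v : X -> R[i], [/\ continuous v, v x = 1, `|phi v| <= 1
    & `|phi v * phi f| <= t].
Proof.
move=> cf fx t0.
pose p y := t + 'i * `|f y|; pose q y := t - 'i * `|f y|.
have tJ : t^* = t by apply/CrealP; exact: gtr0_real.
have pJ y : (p y)^* = q y.
  by rewrite /p /q rmorphD rmorphM /= conjCi tJ conj_normC mulNr.
have qJ y : (q y)^* = p y by rewrite -pJ conjCK.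
have pq y : p y * q y = t ^+ 2 + `|f y| ^+ 2.
  by rewrite mulrC /p /q -subr_sqr exprMn sqrCi mulN1r opprK.
have pqn0 y : p y * q y != 0.
  by rewrite pq gt_eqF// ltr_wpDr ?exprn_ge0 ?exprn_gt0.
have pn0 y : p y != 0 by move: (pqn0 y); rewrite mulf_eq0 negb_or => /andP[].
have qn0 y : q y != 0 by move: (pqn0 y); rewrite mulf_eq0 negb_or => /andP[].
have cn : continuous (fun y => 'i * `|f y| : R[i]).
  by move=> y; apply: cvgM; [exact: cvg_cst|apply: cvg_norm; exact: cf].
have cp : continuous p by move=> y; apply: cvgD; [exact: cvg_cst|exact: cn].
have cq : continuous q by move=> y; apply: cvgB; [exact: cvg_cst|exact: cn].
pose w y := p y / q y; pose w' y := q y / p y.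
have cw : continuous w by move=> y; apply: cvgM; [exact: cp|apply: cvgV; [exact: qn0|exact: cq]].
have cw' : continuous w' by move=> y; apply: cvgM; [exact: cq|apply: cvgV; [exact: pn0|exact: cp]].
have wJ y : (w y)^* = w' y by rewrite /w /w' rmorphM fmorphV /= pJ qJ.
have w'J y : (w' y)^* = w y by rewrite -wJ conjCK.
have nw : `|phi w| <= 1.
  by apply: cx_unitary => // y; rewrite wJ; case: (cayley_fieldE (pn0 y) (qn0 y)).
have nw' : `|phi w'| <= 1.
  by apply: cx_unitary => // y; rewrite w'J; case: (cayley_fieldE (pn0 y) (qn0 y)).
have c1 : continuous (fun _ : X => 1 : R[i]) by move=> y; exact: cvg_cst.
pose v y := 4^-1 * (2 * 1 + (w y + w' y)).
pose g y := 4^-1 * (w y + (-1) * w' y).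
have cww : continuous (fun y => w y + w' y).
  by move=> y; apply: cvgD; [exact: cw|exact: cw'].
have cNw : continuous (fun y => (-1) * w' y : R[i]).
  by move=> y; apply: cvgM; [exact: cvg_cst|exact: cw'].
have cwNw : continuous (fun y => w y + (-1) * w' y : R[i]).
  by move=> y; apply: cvgD; [exact: cw|exact: cNw].
have c2 : continuous (fun y => 2 * 1 + (w y + w' y) : R[i]).
  by move=> y; apply: cvgD; [exact: cvg_cst|exact: cww].
have cv : continuous v by move=> y; apply: cvgM; [exact: cvg_cst|exact: c2].
have cg : continuous g by move=> y; apply: cvgM; [exact: cvg_cst|exact: cwNw].
have n4 : `|4^-1 : R[i]| = 4^-1 by rewrite ger0_norm// invr_ge0 ler0n.
have nv : `|phi v| <= 1.
  rewrite /v (cxZ _ c2) (cx_lin 2 c1 cww) cx1 (cxD cw cw') normrZ n4.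
  rewrite ler_pdivrMl ?ltr0n// mulr1.
  apply: le_trans (ler_normD _ _) _; rewrite normrZ normr_nat.
  apply: (@le_trans _ _ (2 * 1 + (1 + 1))); last by rewrite sumr_ones.
  apply: lerD; first by rewrite ler_wpM2l ?ler0n ?ler_cnorm1.
  by apply: le_trans (ler_normD _ _) _; exact: lerD.
have ng : `|phi g| <= 1.
  rewrite /g (cxZ _ cwNw) (cxD cw cNw) (cxZ _ cw') normrZ n4.
  rewrite ler_pdivrMl ?ltr0n// mulr1.
  apply: le_trans (ler_normD _ _) _; rewrite normrZ normrN1 mul1r.
  by apply: (@le_trans _ _ (1 + 1)); [exact: lerD|rewrite sumr_ones].
exists v; split => //.
  by rewrite /v /w /w' /p /q fx normr0 mulr0 addr0 subr0 divff ?gt_eqF// four_quarters.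
have cvf : continuous (fun y => v y * f y).
  by move=> y; apply: cvgM; [exact: cv|exact: cf].
have cgg : continuous (fun y => g y * g y).
  by move=> y; apply: cvgM; exact: cg.
rewrite -(@ler_pXn2r _ 2) ?nnegrE ?normr_ge0 ?(ltW t0)//.
rewrite -(cxM cv cf) -normr_star_mul -(cxJ cvf).
rewrite -(cxM (conjC_continuous cvf) cvf).
rewrite (_ : (fun y => _) = fun y => - t ^+ 2 * (g y * g y)); last first.
  apply/funext => y; rewrite rmorphM /= mulrACA [X in _ * X]mulrC -normCK.
  have -> : (v y)^* = v y.
    by rewrite /v rmorphM fmorphV !rmorphD rmorphM /= !rmorph_nat wJ w'J [w' y + _]addrC rmorph1.
  have -> : t = (p y + q y) / 2 by rewrite (midpointE _ _).1.
  have -> : `|f y| ^+ 2 = - ((p y - q y) / 2) ^+ 2.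
    rewrite (_ : (p y - q y) / 2 = 'i * `|f y|); last by rewrite (midpointE _ _).2.
    by rewrite exprMn sqrCi mulN1r opprK.
  by case: (cayley_fieldE (pn0 y) (qn0 y)).
rewrite (cxZ _ cgg) (cxM cg cg) normrZ normrN ger0_norm ?exprn_ge0 ?(ltW t0)//.
apply: ler_piMr; first by rewrite exprn_ge0 ?(ltW t0)//.
apply: le_trans (ler_cnormM _ _) _.
by rewrite -[leRHS]mulr1; apply: ler_pM.
Qed.

End CXFacts.

Section IdealFacts.
Variables (R : realType) (X : topologicalType) (A : cstarAlgType R).

Lemma closed_normP (I : set A) : closed I <->
  forall a, (forall e : R[i], 0 < e -> exists2 b, I b & `|a - b| < e) -> I a.
Proof.
rewrite closure_id; split=> [eI a h|h].
  rewrite eI.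
  move=> B /nbhs_normP[e /= e0 eB]; have [b Ib ab] := h e e0.
  by exists b; split => //; apply: eB.
apply/seteqP; split; first exact: subset_closure.
move=> a ca; apply: h => e e0.
have [b [Ib ab]] : I `&` ball_ Num.norm a e !=set0.
  by apply: ca; rewrite ball_normE; apply: nbhsx_ballx.
by exists b.
Qed.

Variables (phi : CX_structure X A) (x : X).
Let J := fiber_ideal phi x.

Lemma fiber_ideal_star a : J a -> J (star a).
Proof.
have [cJ J0 JD JM] := fiber_ideal_closed phi x.
suff h : J `<=` [set b | J (star b)] by exact: h.
move=> b Jb; apply: Jb; split; first split.
- apply/closed_normP => c h; apply: (iffLR (closed_normP J) cJ) => e e0.
  have [d Jd cd] := h e e0; exists (star d) => //.
  by rewrite -starN -starD normr_star.
- by rewrite /= -(scale0r (0 : A)) starZ rmorph0 scale0r.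
- by move=> c d /= Jc Jd; rewrite starD; exact: JD.
- by move=> c d /= Jd; rewrite !starMr; case: (JM (star c) _ Jd).
- move=> _ [f [cf fx] <-] /=; rewrite -cxJ//; apply: fiber_ideal_cx.
    exact: conjC_continuous.
  by rewrite fx conjC0.
Qed.

Definition fiber_unit (v : X -> R[i]) :=
  [/\ continuous v, v x = 1 & `|phi v| <= 1].

Lemma fiber_unit1 : fiber_unit (fun=> 1).
Proof. by split=> //; [move=> y; exact: cvg_cst|rewrite cx1 ler_cnorm1]. Qed.

Lemma fiber_unitM v w : fiber_unit v -> fiber_unit w ->
  fiber_unit (fun y => v y * w y).
Proof.
move=> [cv v1 nv] [cw w1 nw]; split.
- by move=> y; apply: cvgM; [exact: cv|exact: cw].
- by rewrite v1 w1 mulr1.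
- rewrite (cxM phi cv cw); apply: le_trans (ler_cnormM _ _) _.
  by rewrite -[leRHS]mulr1; apply: ler_pM.
Qed.

Lemma fiber_unit_ler v (a : A) : fiber_unit v -> `|phi v * a| <= `|a|.
Proof.
move=> [_ _ nv]; apply: le_trans (ler_cnormM _ _) _.
by rewrite -[leRHS]mul1r; apply: ler_wpM2r.
Qed.

Lemma fiber_approx_unit j : J j -> forall e : R[i], 0 < e ->
  exists2 v, fiber_unit v & `|phi v * j| <= e.
Proof.
pose J' := [set j | forall e : R[i], 0 < e ->
  exists2 v, fiber_unit v & `|phi v * j| <= e].
suff h : J `<=` J' by exact: h.
move=> b Jb; apply: Jb; split; first split.
- apply/closed_normP => a h e e0.
  have e20 : 0 < e / 2 by rewrite divr_gt0 ?ltr0n.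
  have [c Jc ac] := h _ e20; have [v uv vc] := Jc _ e20.
  exists v => //; rewrite -(subrK c a) mulrDr.
  apply: le_trans (ler_normD _ _) _; rewrite [leRHS]splitr; apply: lerD => //.
  by apply: le_trans (fiber_unit_ler _ uv) (ltW ac).
- move=> e e0; exists (fun=> 1); first exact: fiber_unit1.
  by rewrite mulr0 normr0 ltW.
- move=> a c Ja Jc e e0.
  have e20 : 0 < e / 2 by rewrite divr_gt0 ?ltr0n.
  have [v uv va] := Ja _ e20; have [w uw wc] := Jc _ e20.
  have [cv _ _] := uv; have [cw _ _] := uw.
  exists (fun y => v y * w y); first exact: fiber_unitM.
  rewrite mulrDr (cxM phi cv cw) (cx_central phi (phi w) cv).
  apply: le_trans (ler_normD _ _) _; rewrite [leRHS]splitr; apply: lerD.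
    by rewrite -mulrA; apply: le_trans (fiber_unit_ler _ uw) va.
  rewrite -(cx_central phi (phi w) cv) -mulrA.
  by apply: le_trans (fiber_unit_ler _ uv) wc.
- move=> a c Jc; split=> e e0.
    have n0 : 0 < `|a| + 1 by rewrite ltr_wpDl ?normr_ge0.
    have [v uv vc] := Jc _ (divr_gt0 e0 n0); have [cv _ _] := uv.
    exists v => //; rewrite mulrA (cx_central phi a cv) -mulrA.
    apply: le_trans (ler_cnormM _ _) _.
    apply: (@le_trans _ _ ((`|a| + 1) * (e / (`|a| + 1)))).
      by apply: ler_pM => //; rewrite lerDl.
    by rewrite mulrC divfK// gt_eqF.
  have n0 : 0 < `|a| + 1 by rewrite ltr_wpDl ?normr_ge0.
  have [v uv vc] := Jc _ (divr_gt0 e0 n0); have [cv _ _] := uv.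
  exists v => //; rewrite mulrA; apply: le_trans (ler_cnormM _ _) _.
  apply: (@le_trans _ _ ((e / (`|a| + 1)) * (`|a| + 1))).
    by apply: ler_pM => //; rewrite lerDl.
  by rewrite divfK// gt_eqF.
- move=> _ [f [cf fx] <-] e e0.
  have [v [cv v1 nv vf]] := cx_approx_unit phi cf fx e0.
  by exists v.
Qed.

Lemma fiber_ideal_unit v (a : A) : fiber_unit v -> J (phi v * a - a).
Proof.
move=> [cv v1 _]; have [cJ J0 JD JM] := fiber_ideal_closed phi x.
have c1 : continuous (fun _ : X => 1 : R[i]) by move=> y; exact: cvg_cst.
rewrite -[X in _ - X]mul1r -mulrBl -(cx1 phi).
have -> : phi v - phi (fun=> 1) = phi (fun y => (-1) * 1 + v y).
  by rewrite (cx_lin phi _ c1 cv) scaleN1r addrC.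
apply (JM a); apply: fiber_ideal_cx; last by rewrite v1 mulr1 addNr.
by move=> y; apply: cvgD; [exact: cvg_cst|exact: cv].
Qed.

End IdealFacts.

Section FiberAlgebra.
Variables (R : realType) (X : topologicalType) (A : cstarAlgType R).
Variables (phi : CX_structure X A) (x : X).
Local Notation J := (fiber_ideal phi x).
Local Notation F := (fiber phi x).
Local Notation pi := (@fiber_pi R X A phi x).
Local Notation rp := (@fiber_repr R X A phi x).

Lemma fiber_repr_pi a : J (rp (pi a) - a).
Proof. by apply/fiber_piP; exact: fiber_reprK. Qed.

Definition fiber_mul (u v : F) : F := pi (rp u * rp v).
Definition fiber_scale (c : R[i]) (u : F) : F := pi (c *: rp u).
Definition fiber_star (u : F) : F := pi (star (rp u)).

Lemma fiber_mulE a b : fiber_mul (pi a) (pi b) = pi (a * b).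
Proof.
apply/fiber_piP; have [_ _ JD JM] := fiber_ideal_closed phi x.
rewrite -(subrK (a * rp (pi b)) (_ * _)) -mulrBl -addrA -mulrBr.
apply: JD; first by apply (JM _ _ (fiber_repr_pi a)).
by apply (JM _ _ (fiber_repr_pi b)).
Qed.

Lemma fiber_scaleE c a : fiber_scale c (pi a) = pi (c *: a).
Proof.
apply/fiber_piP; have [_ _ JD JM] := fiber_ideal_closed phi x.
rewrite -scalerBr -[X in _ *: X]mul1r cscalerAl.
by apply (JM _ _ (fiber_repr_pi a)).
Qed.

Lemma fiber_starE a : fiber_star (pi a) = pi (star a).
Proof.
apply/fiber_piP; rewrite -starN -starD.
by apply: fiber_ideal_star; exact: fiber_repr_pi.
Qed.

Lemma fiber_scaleA c d u : fiber_scale c (fiber_scale d u) = fiber_scale (c * d) u.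
Proof. by rewrite -(fiber_reprK u) !fiber_scaleE scalerA. Qed.

Lemma fiber_scale1 : left_id 1 fiber_scale.
Proof. by move=> u; rewrite -(fiber_reprK u) fiber_scaleE scale1r. Qed.

Lemma fiber_scaleDr : right_distributive fiber_scale +%R.
Proof.
move=> c u v; rewrite -(fiber_reprK u) -(fiber_reprK v) -fiber_piD.
by rewrite !fiber_scaleE scalerDr fiber_piD.
Qed.

Lemma fiber_scaleDl u : {morph fiber_scale^~ u : c d / c + d}.
Proof.
by move=> c d; rewrite -(fiber_reprK u) !fiber_scaleE scalerDl fiber_piD.
Qed.

HB.instance Definition _ := GRing.Zmodule_isLmodule.Build R[i] F
  fiber_scaleA fiber_scale1 fiber_scaleDr fiber_scaleDl.

Definition fiber_norm (u : F) : R := inf [set nrm a | a in [set a | pi a = u]].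

Lemma fiber_norm_nonempty u : [set nrm a | a in [set a | pi a = u]] !=set0.
Proof. by exists (nrm (rp u)), (rp u) => //; exact: fiber_reprK. Qed.

Lemma fiber_norm_ge0 u : 0 <= fiber_norm u.
Proof.
apply: lb_le_inf; first exact: fiber_norm_nonempty.
by move=> _ [a _ <-]; exact: nrm_ge0.
Qed.

Lemma fiber_norm_le a : fiber_norm (pi a) <= nrm a.
Proof.
apply: ge_inf; last by exists a.
by exists 0 => _ [b _ <-]; exact: nrm_ge0.
Qed.

Lemma fiber_norm_lt u (e : R) : 0 < e -> exists2 a, pi a = u & nrm a < fiber_norm u + e.
Proof.
move=> e0.
have [|_ [a pa <-] h] := @inf_adherent R [set nrm a | a in [set a | pi a = u]] e e0.
  split; first exact: fiber_norm_nonempty.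
  by exists 0 => _ [b _ <-]; exact: nrm_ge0.
by exists a.
Qed.

Definition fiber_cnorm (u : F) : R[i] := (fiber_norm u)%:C%C.

Lemma nrmD (a b : A) : nrm (a + b) <= nrm a + nrm b.
Proof. by rewrite -lecR rmorphD /= -!nrmE ler_normD. Qed.

Lemma nrmM (a b : A) : nrm (a * b) <= nrm a * nrm b.
Proof. by rewrite -lecR rmorphM /= -!nrmE ler_cnormM. Qed.

Lemma fiber_norm_triangle u v : fiber_norm (u + v) <= fiber_norm u + fiber_norm v.
Proof.
apply/ler_addgt0Pr => e e0; have e20 : 0 < e / 2 by rewrite divr_gt0.
have [a <- ua] := fiber_norm_lt u e20; have [b <- vb] := fiber_norm_lt v e20.
rewrite -fiber_piD; apply: le_trans (fiber_norm_le _) _.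
apply: le_trans (nrmD _ _) _; rewrite (splitr e) addrACA.
by apply: lerD; exact: ltW.
Qed.

Lemma fiber_cnorm_triangle u v : fiber_cnorm (u + v) <= fiber_cnorm u + fiber_cnorm v.
Proof. by rewrite /fiber_cnorm -rmorphD lecR fiber_norm_triangle. Qed.

Lemma fiber_cnormZ_le (c : R[i]) u : fiber_cnorm (c *: u) <= `|c| * fiber_cnorm u.
Proof.
have [r [r0 cr]] : exists r : R, 0 <= r /\ `|c| = r%:C%C.
  exists (complex.Re `|c|); have := normr_ge0 c.
  by case: `|c| => r s; rewrite lecE /= => /andP[/eqP -> ?].
rewrite cr /fiber_cnorm -rmorphM lecR /=.
apply/ler_addgt0Pr => e e0.
have r1 : 0 < r + 1 by rewrite ltr_wpDl.
have [a <- ua] := fiber_norm_lt u (divr_gt0 e0 r1).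
rewrite -[_ *: _]/(fiber_scale _ _) fiber_scaleE.
apply: le_trans (fiber_norm_le _) _.
have -> : nrm (c *: a) = r * nrm a.
  by apply: complexI; rewrite rmorphM /= -!nrmE normrZ cr.
apply: (@le_trans _ _ (r * (fiber_norm (pi a) + e / (r + 1)))).
  by apply: ler_wpM2l => //; exact: ltW.
rewrite mulrDr lerD2l mulrCA -[leRHS]mulr1.
apply: ler_wpM2l; first exact: ltW.
by rewrite ler_pdivrMr// mul1r lerDl.
Qed.

Lemma fiber_cnormZ (c : R[i]) u : fiber_cnorm (c *: u) = `|c| * fiber_cnorm u.
Proof.
apply/eqP; rewrite eq_le fiber_cnormZ_le /=.
have [->|c0] := eqVneq c 0.
  by rewrite normr0 mul0r /fiber_cnorm ler0c fiber_norm_ge0.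
have nc : 0 < `|c| by rewrite normr_gt0.
rewrite -ler_pdivlMl// -normfV -{1}[u](scalerK c0) //.
exact: fiber_cnormZ_le.
Qed.

Lemma fiber_cnorm_eq0 u : fiber_cnorm u = 0 -> u = 0.
Proof.
move=> h; have {}h : fiber_norm u = 0 by apply: complexI; exact: h.
have [cJ J0 JD JM] := fiber_ideal_closed phi x.
rewrite -(fiber_reprK u) -(@fiber_pi0 _ _ _ phi x); apply/fiber_piP; rewrite subr0.
apply: (iffLR (closed_normP J) cJ) => e e0.
have [r er] : exists r, e = r%:C%C.
  by case: e e0 => r s; rewrite ltcE /= => /andP[/eqP -> _]; exists r.
move: e0; rewrite er ltcR => r0.
have [a pa] := fiber_norm_lt u r0; rewrite h add0r => ar.
exists (rp u - a); first by apply/fiber_piP; rewrite fiber_reprK.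
by rewrite subKr nrmE ltcR.
Qed.

HB.instance Definition _ := Lmodule_isNormed.Build R[i] F
  fiber_cnorm_triangle fiber_cnormZ fiber_cnorm_eq0.
End FiberAlgebra.

Section FiberCstar.
Variables (R : realType) (X : topologicalType) (A : cstarAlgType R).
Variables (phi : CX_structure X A) (x : X).
Local Notation J := (fiber_ideal phi x).
Local Notation F := (fiber phi x).
Local Notation pi := (@fiber_pi R X A phi x).
Local Notation rp := (@fiber_repr R X A phi x).

Lemma exp_half_lt (e : R) : 0 < e -> exists N, forall n, (N <= n)%N -> (2^-1) ^+ n < e.
Proof.
move=> e0; exists (Num.truncn e^-1) => n Nn.
rewrite exprVn -(invrK e) ltf_pV2 ?posrE ?invr_gt0 ?exprn_gt0//.
apply: lt_le_trans (truncnS_gt _) _; rewrite -natrX ler_nat.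
by apply: leq_ltn_trans Nn _; exact: ltn_expl.
Qed.

Lemma fiber_complete (G : set_system F) : ProperFilter G -> cauchy G -> cvg G.
Proof.
move=> PG /cauchyP cG; pose d n : R := (2^-1) ^+ n.
have d0 n : 0 < d n by rewrite exprn_gt0 ?invr_gt0.
have dS n : d n = d n.+1 + d n.+1.
  by rewrite /d exprS; set y := 2^-1 ^+ n; lra.
have /choice[u uG] : forall n, exists u : F, G (ball u (d n)%:C%C).
  by move=> n; apply: cG; rewrite (ltcR 0).
have uS n : fiber_norm (u n.+1 - u n) < 2 * d n.
  have [w [wn wSn]] := filter_ex (filterI (uG n) (uG n.+1)).
  move: wn wSn; rewrite -!ball_normE /= => wn wSn.
  have : `|u n.+1 - u n| < (d n.+1)%:C%C + (d n)%:C%C.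
    rewrite -(subrK w (u n.+1)) -addrA.
    by apply: le_lt_trans (ler_normD _ _) _; apply: ltrD => //; rewrite distrC.
  rewrite -[X in X < _]/((fiber_norm (u n.+1 - u n))%:C%C) -rmorphD ltcR => h.
  apply: lt_le_trans h _; rewrite mulr2n mulrDl mul1r lerD2r.
  by rewrite (dS n) lerDl ltW.
have lift n (a : A) : exists b : A, pi a = u n ->
    pi b = u n.+1 /\ nrm (b - a) < 2 * d n.
  have e0 : 0 < 2 * d n - fiber_norm (u n.+1 - u n) by rewrite subr_gt0.
  have [c pc] := fiber_norm_lt (u n.+1 - u n) e0.
  rewrite addrC subrK => nc; exists (a + c) => pa.
  by rewrite fiber_piD pa pc addrC subrK addrC addKr.
have /choice[g gP] : forall na : nat * A, exists b : A, pi na.2 = u na.1 ->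
    pi b = u na.1.+1 /\ nrm (b - na.2) < 2 * d na.1 by move=> [n a]; exact: lift.
pose fix a n := if n is m.+1 then g (m, a m) else rp (u 0%N).
have pa n : pi (a n) = u n.
  elim: n => [|n IH]; first exact: fiber_reprK.
  by case: (gP (n, a n) IH).
have aS n : nrm (a n.+1 - a n) < 2 * d n by case: (gP (n, a n) (pa n)).
have aD n k : nrm (a (n + k)%N - a n) <= 4 * d n - 4 * d (n + k)%N.
  elim: k => [|k IH].
    rewrite addn0 !subrr -lecR -nrmE normr0 //.
  rewrite addnS -(subrK (a (n + k)%N) (a (n + k).+1)) -addrA.
  apply: le_trans (nrmD _ _) _.
  apply: le_trans (lerD (ltW (aS _)) IH) _.
  by rewrite (dS (n + k)%N); lra.
have aN e : 0 < e -> exists N, forall n, (N <= n)%N -> nrm (a n - a N) < e.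
  move=> e0; have e40 : 0 < e / 4 by rewrite divr_gt0.
  have [N NP] := exp_half_lt e40; exists N => n Nn.
  rewrite -(subnKC Nn); apply: le_lt_trans (aD _ _) _.
  have := NP N (leqnn N); rewrite -[_ ^+ _]/(d N) => h.
  by have := d0 (N + (n - N))%N; lra.
have toR (e : R[i]) : 0 < e -> exists2 r : R, 0 < r & e = r%:C%C.
  by case: e => r s; rewrite ltcE /= => /andP[/eqP -> ?]; exists r.
have : cvg (a @ \oo).
  apply: cauchy_cvg; apply: cauchy_exP => e /toR[r r0 ->].
  have [N NP] := aN _ r0; exists (a N); exists N => // n /= Nn.
  by rewrite -ball_normE /= distrC nrmE ltcR; exact: NP.
move=> /cvg_ex[l /cvgrPdist_lt al].
apply/cvg_ex; exists (pi l); apply/fcvgrPdist_lt => e /toR[r r0 ->].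
have r2 : 0 < r / 2 by rewrite divr_gt0.
have [|N _ NP] := al (r / 2)%:C%C; first by rewrite (ltcR 0).
have [M MP] := exp_half_lt r2.
pose n := maxn N M.
have h1 : fiber_norm (pi l - u n) < r / 2.
  rewrite -pa -fiber_piN -fiber_piD; apply: le_lt_trans (fiber_norm_le _ _ _) _.
  by rewrite -ltcR -nrmE; apply: NP; rewrite /= leq_maxl.
apply: filterS (uG n) => w; rewrite -ball_normE /= => h2.
rewrite -(subrK (u n) (pi l)) -addrA.
apply: le_lt_trans (ler_normD _ _) _.
rewrite (splitr r) rmorphD /=; apply: ltrD; first by rewrite -[X in X < _]/((fiber_norm _)%:C%C) ltcR.
by apply: lt_trans h2 _; rewrite ltcR; apply: MP; rewrite leq_maxr.
Qed.

HB.instance Definition _ := Uniform_isComplete.Build F fiber_complete.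

Local Notation mul := (@fiber_mul R X A phi x).
Local Notation fstar := (@fiber_star R X A phi x).
Let scaleE (c : R[i]) a : c *: pi a = pi (c *: a).
Proof. exact: fiber_scaleE. Qed.

Lemma fiber_mulA : associative mul.
Proof.
move=> u v w; rewrite -(fiber_reprK u) -(fiber_reprK v) -(fiber_reprK w).
by rewrite !fiber_mulE mulrA.
Qed.

Lemma fiber_mul1 : left_id (pi 1) mul.
Proof. by move=> u; rewrite -(fiber_reprK u) fiber_mulE mul1r. Qed.

Lemma fiber_mulr1 : right_id (pi 1) mul.
Proof. by move=> u; rewrite -(fiber_reprK u) fiber_mulE mulr1. Qed.

Lemma fiber_mulDl : left_distributive mul +%R.
Proof.
move=> u v w; rewrite -(fiber_reprK u) -(fiber_reprK v) -(fiber_reprK w).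
by rewrite -fiber_piD !fiber_mulE mulrDl fiber_piD.
Qed.

Lemma fiber_mulDr : right_distributive mul +%R.
Proof.
move=> u v w; rewrite -(fiber_reprK u) -(fiber_reprK v) -(fiber_reprK w).
by rewrite -fiber_piD !fiber_mulE mulrDr fiber_piD.
Qed.

Lemma fiber_scaleAl (c : R[i]) u v : c *: mul u v = mul (c *: u) v.
Proof.
rewrite -(fiber_reprK u) -(fiber_reprK v) fiber_mulE !scaleE fiber_mulE.
by rewrite cscalerAl.
Qed.

Lemma fiber_scaleAr (c : R[i]) u v : c *: mul u v = mul u (c *: v).
Proof.
rewrite -(fiber_reprK u) -(fiber_reprK v) fiber_mulE !scaleE fiber_mulE.
by rewrite cscalerAr.
Qed.

Lemma fiber_starK : involutive fstar.
Proof. by move=> u; rewrite -(fiber_reprK u) !fiber_starE starK. Qed.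

Lemma fiber_starD : {morph fstar : u v / u + v}.
Proof.
move=> u v; rewrite -(fiber_reprK u) -(fiber_reprK v) -fiber_piD !fiber_starE.
by rewrite starD fiber_piD.
Qed.

Lemma fiber_starZ (c : R[i]) u : fstar (c *: u) = c^* *: fstar u.
Proof. by rewrite -(fiber_reprK u) scaleE !fiber_starE starZ scaleE. Qed.

Lemma fiber_starM u v : fstar (mul u v) = mul (fstar v) (fstar u).
Proof.
rewrite -(fiber_reprK u) -(fiber_reprK v) fiber_mulE !fiber_starE fiber_mulE.
by rewrite starMr.
Qed.

Lemma fiber_normM u v : `|mul u v| <= `|u| * `|v|.
Proof.
rewrite -[X in X <= _]/((fiber_norm _)%:C%C) -[`|u| * _]/((fiber_norm u)%:C%C * (fiber_norm v)%:C%C).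
rewrite -rmorphM lecR; apply/ler_addgt0Pr => e e0.
have nu := fiber_norm_ge0 u; have nv := fiber_norm_ge0 v.
pose K := fiber_norm u + fiber_norm v + 1.
have K0 : 0 < K by rewrite ltr_wpDl ?addr_ge0.
pose d := Num.min 1 (e / K).
have d0 : 0 < d by rewrite lt_min ltr01 divr_gt0.
have [a pa ua] := fiber_norm_lt u d0; have [b pb vb] := fiber_norm_lt v d0.
rewrite -{1}pa -{1}pb fiber_mulE; apply: le_trans (fiber_norm_le _ _ _) _.
apply: le_trans (nrmM _ _) _.
apply: (@le_trans _ _ ((fiber_norm u + d) * (fiber_norm v + d))).
  by apply: ler_pM; rewrite ?nrm_ge0 ?ltW.
have dK : d * K <= e by rewrite -ler_pdivlMr// ge_min lexx orbT.
have d1 : d <= 1 by rewrite ge_min lexx.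
have dd : d * d <= d * 1 by apply: ler_wpM2l => //; exact: ltW.
move: dK; rewrite /K => dK.
set U := fiber_norm u in dK *; set V := fiber_norm v in dK *.
have -> : (U + d) * (V + d) = U * V + (d * (U + V) + d * d) by ring.
rewrite lerD2l; apply: le_trans dK.
by rewrite [leRHS]mulrDr lerD2l.
Qed.

Lemma fiber_normr_star_le u : fiber_norm (fstar u) <= fiber_norm u.
Proof.
apply: lb_le_inf; first exact: fiber_norm_nonempty.
move=> _ [a <- <-]; rewrite fiber_starE.
apply: le_trans (fiber_norm_le _ _ _) _.
by rewrite -lecR -!nrmE normr_star.
Qed.

Lemma fiber_cstar u : `|mul (fstar u) u| = `|u| ^+ 2.
Proof.
apply/eqP; rewrite eq_le; apply/andP; split.
  apply: le_trans (fiber_normM _ _) _; rewrite expr2; apply: ler_wpM2r => //.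
  by rewrite -[`|fstar u|]/((fiber_norm _)%:C%C) lecR fiber_normr_star_le.
rewrite -[`|mul _ _|]/((fiber_norm _)%:C%C) -[`|u|]/((fiber_norm u)%:C%C).
rewrite -rmorphXn lecR.
apply: lb_le_inf; first exact: fiber_norm_nonempty.
rewrite -(fiber_reprK u); set a := rp u.
move=> _ [b pb <-]; apply/ler_addgt0Pr => e e0.
move: pb; rewrite fiber_starE fiber_mulE => /esym /fiber_piP Jab.
have eC : 0 < e%:C%C by rewrite (ltcR 0).
have [v uv vJ] := fiber_approx_unit Jab eC.
have [cv _ _] := uv.
have pva : pi (phi v * a) = pi a by apply/fiber_piP; exact: fiber_ideal_unit.
have h : nrm (phi v * a) ^+ 2 <= nrm b + e; last first.
  apply: le_trans h; rewrite -[X in fiber_norm X]pva.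
  by rewrite ler_pXn2r ?nnegrE ?fiber_norm_ge0 ?nrm_ge0// fiber_norm_le.
rewrite -lecR rmorphXn rmorphD /= -!nrmE -normr_star_mul starMr -(cxJ phi cv).
have cvJ := conjC_continuous cv.
rewrite mulrA -(mulrA (star a)) -(cxM phi cvJ cv).
have cvv : continuous (fun y => (v y)^* * v y).
  by move=> y; apply: cvgM; [exact: cvJ|exact: cv].
rewrite -(cx_central phi (star a) cvv) -mulrA (cxM phi cvJ cv) (cxJ phi cv).
have nst (c : A) : `|star (phi v) * (phi v * c)| <= `|phi v * c|.
  apply: le_trans (ler_cnormM _ _) _; rewrite normr_star -[leRHS]mul1r.
  by apply: ler_wpM2r => //; case: uv.
rewrite -mulrA -(subrK b (star a * a)) (mulrDr (phi v)) (mulrDr (star (phi v))) addrC.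
apply: le_trans (ler_normD _ _) _; apply: lerD.
  by apply: le_trans (nst _) (fiber_unit_ler _ uv).

by apply: le_trans (nst _) vJ.
Qed.

HB.instance Definition _ := isCstarAlgebra.Build R F
  fiber_mulA fiber_mul1 fiber_mulr1 fiber_mulDl fiber_mulDr
  fiber_scaleAl fiber_scaleAr fiber_starK fiber_starD fiber_starZ fiber_starM
  fiber_normM fiber_cstar.

End FiberCstar.

(* *-homomorphisms are contractive; this is what lets an action descend to the
   fibers. *)
Section AutomaticContinuity.
Variable R : realType.

Lemma star0 (A : cstarAlgType R) : star 0 = 0 :> A.
Proof. by rewrite -[in LHS](scale0r (0 : A)) starZ rmorph0 scale0r. Qed.

Lemma seq_lim_unique (A : cstarAlgType R) (u : nat -> A) (a b : A) :
  u n @[n --> \oo] --> a -> u n @[n --> \oo] --> b -> a = b.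
Proof.
move=> ua ub; have hA := @norm_hausdorff _ A.
by rewrite -(cvg_lim hA ua) (cvg_lim hA ub).
Qed.

Lemma cvg_cmul (A : cstarAlgType R) (u v : nat -> A) (a b : A) :
  u n @[n --> \oo] --> a -> v n @[n --> \oo] --> b ->
  (u n * v n) @[n --> \oo] --> a * b.
Proof.
move=> /cvgrPdist_le ua /cvgrPdist_le vb; apply/cvgrPdist_le => e e0.
have a1 : 0 < `|a| + 1 by rewrite ltr_wpDl ?normr_ge0.
have b1 : 0 < `|b| + 1 by rewrite ltr_wpDl ?normr_ge0.
have e2 : 0 < e / 2 by rewrite divr_gt0 ?ltr0n.
have h1 := vb _ (divr_gt0 e2 a1); have h2 := ua _ (divr_gt0 e2 b1).
have h3 := vb _ ltr01.
near=> n.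
have -> : a * b - u n * v n = a * (b - v n) + (a - u n) * v n.
  by rewrite mulrBr mulrBl addrA subrK.
apply: le_trans (ler_normD _ _) _; rewrite [leRHS]splitr; apply: lerD.
  apply: le_trans (ler_cnormM _ _) _.
  apply: (@le_trans _ _ ((`|a| + 1) * (e / 2 / (`|a| + 1)))).
    by apply: ler_pM => //; [rewrite lerDl|near: n].
  by rewrite mulrC divfK// gt_eqF.
apply: le_trans (ler_cnormM _ _) _.
apply: (@le_trans _ _ (e / 2 / (`|b| + 1) * (`|b| + 1))).
  apply: ler_pM => //; first by near: n.
  rewrite -[X in `|X| <= _](subrK b) addrC.
  apply: le_trans (ler_normD _ _) _; rewrite lerD2l distrC; by near: n.
by rewrite divfK// gt_eqF.
Unshelve. all: by end_near. Qed.

Lemma cvg_star (A : cstarAlgType R) (u : nat -> A) (a : A) :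
  u n @[n --> \oo] --> a -> star (u n) @[n --> \oo] --> star a.
Proof.
move=> /cvgrPdist_le ua; apply/cvgrPdist_le => e /ua; apply: filterS => n.
by rewrite -starN -starD normr_star.
Qed.

Lemma geometric_cvg (A : cstarAlgType R) (a : nat -> A) (c : R) :
  0 <= c < 1 -> (forall n, nrm (a n.+1 - a n) <= c ^+ n) -> cvg (a @ \oo).
Proof.
move=> /andP[c0 c1] ac.
have d0 : 0 < 1 - c by rewrite subr_gt0.
have aD n k : nrm (a (n + k)%N - a n) <= (c ^+ n - c ^+ (n + k)) / (1 - c).
  elim: k => [|k IH].
    by rewrite addn0 !subrr mul0r -lecR -nrmE normr0.
  rewrite addnS -(subrK (a (n + k)%N) (a (n + k).+1)) -addrA.
  apply: le_trans (nrmD _ _) _; apply: le_trans (lerD (ac _) IH) _.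
  rewrite ler_pdivlMr// mulrDl divfK ?gt_eqF// exprS.
  by set z := c ^+ _; set y := c ^+ _; lra.
apply: cauchy_cvg; apply: cauchy_exP => e e0.
have [r r0 ->] : exists2 r : R, 0 < r & e = r%:C%C.
  by case: e e0 => r s; rewrite ltcE /= => /andP[/eqP -> ?]; exists r.
have rd : 0 < r * (1 - c) by rewrite mulr_gt0.
have : c ^+ n @[n --> \oo] --> 0 by apply: cvg_expr; rewrite ger0_norm.
move=> /cvgrPdist_lt /(_ _ rd) [N _ NP].
exists (a N); exists N => // n /= Nn.
rewrite -ball_normE /= distrC nrmE ltcR -(subnKC Nn).
apply: le_lt_trans (aD _ _) _; rewrite ltr_pdivrMr//.
have := NP N (leqnn N); rewrite /= sub0r normrN ger0_norm ?exprn_ge0//.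
by apply: le_lt_trans; rewrite lerBlDr lerDl exprn_ge0.
Qed.

Lemma cstar_sqrt (A : cstarAlgType R) (h : A) : star h = h -> nrm h < 1 ->
  exists k : A, [/\ star k = k, k * h = h * k & h * h + k * k = 1].
Proof.
move=> sh h1; set c := nrm h in h1.
have c0 : 0 <= c by exact: nrm_ge0.
pose x := h * h.
have xc : nrm x <= c.
  by apply: le_trans (nrmM _ _) _; rewrite -/c ler_piMr// ltW.
pose fix a n : A := if n is m.+1 then 2^-1 *: (x + a m * a m) else 0.
have nZ (y : A) : nrm (2^-1 *: y) = 2^-1 * nrm y.
  apply: complexI; rewrite rmorphM fmorphV rmorph_nat /= -!nrmE normrZ.
  by rewrite ger0_norm// invr_ge0 ler0n.
have n0 : nrm (0 : A) = 0 by apply: complexI; rewrite -nrmE normr0.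
have ac n : nrm (a n) <= c.
  elim: n => [|n IH]; first by rewrite n0.
  rewrite /= nZ; apply: (@le_trans _ _ (2^-1 * (c + c * c))).
    rewrite ler_pM2l ?invr_gt0//; apply: le_trans (nrmD _ _) _.
    apply: lerD => //; apply: le_trans (nrmM _ _) _.
    by apply: ler_pM; rewrite ?nrm_ge0.
  have : c * c <= c * 1 by apply: ler_wpM2l => //; exact: ltW.
  by lra.
have as_ n : star (a n) = a n.
  elim: n => [|n IH] /=; first exact: star0.
  by rewrite starZ starD !starMr sh IH fmorphV rmorph_nat.
have ah n : a n * h = h * a n.
  elim: n => [|n IH]; first by rewrite /= mul0r mulr0.
  rewrite [a n.+1]/(2^-1 *: (x + a n * a n)).
  rewrite -cscalerAl -cscalerAr mulrDl mulrDr.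
  by rewrite -(mulrA (a n)) IH (mulrA (a n)) IH !mulrA.
have : cvg (a @ \oo).
  apply: (@geometric_cvg _ _ c); first by rewrite c0.
  elim=> [|n IH].
    by rewrite expr0 subr0; apply: le_trans (ac _) (ltW h1).
  have aE m : a m.+1 = 2^-1 *: (x + a m * a m) by [].
  rewrite (aE n.+1) [X in _ - X](aE n) -scalerBr nZ opprD addrACA subrr add0r.
  have -> : a n.+1 * a n.+1 - a n * a n =
      a n.+1 * (a n.+1 - a n) + (a n.+1 - a n) * a n.
    by rewrite mulrBr mulrBl addrA subrK.
  apply: (@le_trans _ _ (2^-1 * (c * c ^+ n + c ^+ n * c))).
    rewrite ler_pM2l ?invr_gt0//; apply: le_trans (nrmD _ _) _.
    by apply: lerD; apply: le_trans (nrmM _ _) _; apply: ler_pM; rewrite ?nrm_ge0.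
  by rewrite exprS; lra.
move=> /cvg_ex[y ay].
have sy : star y = y.
  apply: (seq_lim_unique (cvg_star ay)).
  by under eq_fun do rewrite as_.
have yh : y * h = h * y.
  apply: (seq_lim_unique (cvg_cmul ay (cvg_cst h))).
  under eq_fun do rewrite ah.
  exact: cvg_cmul (cvg_cst h) ay.
have ye : y = 2^-1 *: (x + y * y).
  have ay1 : a n.+1 @[n --> \oo] --> y by rewrite (cvg_shiftS a (nbhs y)).
  apply: (seq_lim_unique ay1).
  apply: cvgZr; apply: cvgD; [exact: cvg_cst|exact: cvg_cmul].
exists (1 - y); split.
- by rewrite starD starN star1 sy.
- by rewrite mulrBl mulrBr mul1r mulr1 yh.
- have e2 : y + y = x + y * y.
    have := congr1 (fun z : A => (2 : R[i]) *: z) ye.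
    by rewrite scalerA divff ?pnatr_eq0// scale1r scaler_nat mulr2n.
  rewrite mulrBl mul1r mulrBr mulr1 -/x opprB addrACA -opprD addrA (addrCA x).
  by rewrite e2 addrK.
Qed.

Lemma star_hom_contractive (A B : cstarAlgType R) (f : A -> B) (a : A) :
  star_hom f -> `|f a| <= `|a|.
Proof.
move=> [fl [f1 fM] fs].
have fD (b c : A) : f (b + c) = f b + f c.
  by have := fl 1 b c; rewrite !scale1r.
have f0 : f 0 = 0 by have := fD 0 0; rewrite addr0 => /eqP; rewrite -subr_eq subrr => /eqP.
have fZ c (b : A) : f (c *: b) = c *: f b.
  by have := fl c b 0; rewrite !addr0 f0 addr0.
have unit1 (h : A) : star h = h -> nrm h < 1 -> `|f h| <= 1.
  move=> sh h1; have [k [sk kh hk]] := cstar_sqrt sh h1.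
  pose u := h + 'i *: k.
  have su : star u = h - 'i *: k.
    by rewrite /u starD starZ sh sk conjCi scaleNr.
  have uu : star u * u = 1.
    rewrite su /u mulrDr !mulrBl -!cscalerAl -!cscalerAr scalerA -(expr2 'i) sqrCi.
    by rewrite scaleN1r opprK kh addrA subrK.
  have nu : `|f u| <= 1.
    rewrite -(@ler_pXn2r _ 2) ?nnegrE// -normr_star_mul -fs -fM uu f1 expr1n.
    exact: ler_cnorm1.
  have -> : h = 2^-1 *: (u + star u).
    rewrite su /u addrACA subrr addr0.
    have -> : h + h = (2 : R[i]) *: h by rewrite scaler_nat mulr2n.
    by rewrite scalerA mulVf ?scale1r// pnatr_eq0.
  rewrite fZ fD fs normrZ ger0_norm ?invr_ge0 ?ler0n// ler_pdivrMl ?ltr0n//.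
  apply: le_trans (ler_normD _ _) _; rewrite normr_star mulr1.
  by apply: (@le_trans _ _ (1 + 1)); [exact: lerD|rewrite -(natrD _ 1 1)].
have sa (h : A) : star h = h -> `|f h| <= `|h|.
  move=> sh; rewrite !nrmE lecR; apply/ler_addgt0Pr => e e0.
  pose r := nrm h + e.
  have r0 : 0 < r by rewrite ltr_wpDl ?nrm_ge0.
  have rC : 0 < r%:C%C by rewrite (ltcR 0).
  have := unit1 ((r%:C%C)^-1 *: h).
  rewrite starZ sh fmorphV /= (_ : (r%:C%C)^* = r%:C%C); last first.
    by apply/CrealP; exact: gtr0_real.
  move=> /(_ erefl); rewrite -ltcR -nrmE !fZ !normrZ normfV gtr0_norm//.
  rewrite ltr_pdivrMl// ler_pdivrMl// mulr1 !nrmE ltcR lecR; apply.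
  by rewrite ltrDl.
rewrite -(@ler_pXn2r _ 2) ?nnegrE// -!normr_star_mul -fs -fM.
by apply: sa; rewrite starMr starK.
Qed.

End AutomaticContinuity.

Section FiberAction.
Variables (R : realType) (G : zmodType) (X : topologicalType).
Variables (A : cstarAlgType R) (E : equivariant_CX_structure G X A) (x : X).
Local Notation alpha := (cx_act E).
Local Notation J := (fiber_ideal E x).
Local Notation F := (fiber E x).
Local Notation pi := (@fiber_pi R X A E x).
Local Notation rp := (@fiber_repr R X A E x).

Lemma fiber_pi_hom : @star_hom R A F pi.
Proof.
split.
- by move=> c a b; rewrite fiber_piD -fiber_scaleE.
- by split=> [//|a b]; rewrite -fiber_mulE.
- by move=> a; rewrite -fiber_starE.
Qed.

Lemma act_linear g c (a b : A) : alpha g (c *: a + b) = c *: alpha g a + alpha g b.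
Proof. by case: (act_hom alpha g) => h _ _; exact: h. Qed.

Lemma act_mul g (a b : A) : alpha g (a * b) = alpha g a * alpha g b.
Proof. by case: (act_hom alpha g) => _ [_ h] _; exact: h. Qed.

Lemma act_one g : alpha g 1 = 1.
Proof. by case: (act_hom alpha g) => _ [h _] _. Qed.

Lemma act_star g (a : A) : alpha g (star a) = star (alpha g a).
Proof. by case: (act_hom alpha g) => _ _ h; exact: h. Qed.

Lemma act_add g (a b : A) : alpha g (a + b) = alpha g a + alpha g b.
Proof. by have := act_linear g 1 a b; rewrite !scale1r. Qed.

Lemma act_sub g (a b : A) : alpha g (a - b) = alpha g a - alpha g b.
Proof. by have := act_linear g (-1) b a; rewrite !scaleN1r !(addrC (- _)). Qed.

Lemma act_fiber_ideal g a : J a -> J (alpha g a).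
Proof.
have [cJ J0 JD JM] := fiber_ideal_closed E x.
suff h : J `<=` [set b | J (alpha g b)] by exact: h.
move=> b Jb; apply: Jb; split; first split.
- apply/closed_normP => c h; apply: (iffLR (closed_normP J) cJ) => e e0.
  have [d Jd cd] := h e e0; exists (alpha g d) => //.
  rewrite -act_sub; apply: le_lt_trans cd.
  exact: (@star_hom_contractive _ _ _ (alpha g) _ (act_hom alpha g)).
- by rewrite /= -(subrr 0) act_sub subrr.
- by move=> c d /= Jc Jd; rewrite act_add; exact: JD.
- by move=> c d /= Jd; rewrite !act_mul; apply: JM.
- by move=> _ [f [cf fx] <-] /=; rewrite cx_act_fix//; exact: fiber_ideal_cx.
Qed.

Definition fiber_act (g : G) (u : F) : F := pi (alpha g (rp u)).

Lemma fiber_actE g a : fiber_act g (pi a) = pi (alpha g a).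
Proof.
apply/fiber_piP; rewrite -act_sub; apply: act_fiber_ideal.
exact: fiber_repr_pi.
Qed.

Lemma fiber_act_hom g : @star_hom R F F (fiber_act g).
Proof.
have [pl [p1 pM] ps] := fiber_pi_hom; split.
- move=> c u v; rewrite -(fiber_reprK u) -(fiber_reprK v) -pl !fiber_actE.
  by rewrite act_linear pl.
- split; first by rewrite -p1 fiber_actE act_one.
  move=> u v; rewrite -(fiber_reprK u) -(fiber_reprK v) -pM !fiber_actE.
  by rewrite act_mul pM.
- by move=> u; rewrite -(fiber_reprK u) -ps !fiber_actE act_star ps.
Qed.

Lemma fiber_act0 u : fiber_act 0 u = u.
Proof. by rewrite -(fiber_reprK u) fiber_actE act0. Qed.

Lemma fiber_actD g h u : fiber_act (g + h) u = fiber_act g (fiber_act h u).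
Proof. by rewrite -(fiber_reprK u) !fiber_actE actD. Qed.

Definition fiber_action : cstar_action G F :=
  CstarAction fiber_act_hom fiber_act0 fiber_actD.

End FiberAction.

Section WeakLocalTriviality.
Variables (R : realType) (k : nat).

(* Z/k is 'Z_k, which is the cyclic group of order k only for k > 1. *)
Definition cone_space : Type := set_type `[(0 : R), 1]%classic * 'Z_k.

(* C_0((0,1]) (x) C(Z/k), realised as the continuous functions on
   [0,1] x Z/k that vanish on {0} x Z/k. *)
Definition cone_algebra : set (cone_space -> R[i]) :=
  [set f | forall l : 'Z_k, continuous (fun s => f (s, l)) /\
                            (forall s, set_val s = 0 -> f (s, l) = 0)].

Definition cone_translate (g : 'Z_k) (f : cone_space -> R[i]) : cone_space -> R[i] :=
  fun p => f (p.1, p.2 - g).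

(* t (x) 1 *)
Definition cone_t : cone_space -> R[i] := fun p => (set_val p.1)%:C%C.

Variables (B : cstarAlgType R) (beta : cstar_action 'Z_k B).

Definition invertible (b : B) : Prop := exists c, b * c = 1 /\ c * b = 1.

Definition equivariant_cone_hom (rho : (cone_space -> R[i]) -> B) : Prop :=
  fun_star_hom cone_algebra rho /\
  forall (g : 'Z_k) f, cone_algebra f ->
    rho (cone_translate g f) = beta g (rho f).

Definition wlt_witness (n : nat) : Prop :=
  exists rho : 'I_n.+1 -> (cone_space -> R[i]) -> B,
    (forall j, equivariant_cone_hom (rho j)) /\
    invertible (\sum_j rho j cone_t).

Definition dim_WLT : \bar R :=
  ereal_inf [set (n%:R)%:E | n in [set n : nat | wlt_witness n]].

End WeakLocalTriviality.

(* Main.v *)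
Require Import Defs.
From mathcomp Require Import all_boot all_order all_algebra.
From mathcomp Require Import complex.
From mathcomp Require Import cyclic separable cyclotomic.
From mathcomp Require Import zify ring lra.
From mathcomp Require Import all_classical all_reals all_analysis.

Set Implicit Arguments.
Unset Strict Implicit.
Unset Printing Implicit Defensive.

Import Order.TTheory GRing.Theory Num.Theory.
Import numFieldNormedType.Exports.

Local Open Scope classical_set_scope.
Local Open Scope ring_scope.

(** The bound dim <= n holds at x exactly when a witness with i + 1 homomorphisms
    exists for some i <= n, so it suffices that witnesses spread from a fiber to
    the fibers nearby.

    Let rho_0, ..., rho_i be equivariant homomorphisms from the cone
    C_0((0,1]) (x) C(Z/2^m) to A_x such that the sum of the rho_j(t (x) 1) is
    invertible.  For each j there is an equivariant homomorphism from the cone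
    to A itself whose value at t (x) 1 has image rho_j(t (x) 1) in A_x
    ([cone_lift]).  Composed with the quotient maps A -> A_y these give
    equivariant homomorphisms to every fiber, and the sums to be inverted are
    the images of one element b of A.  The norm of the image of a fixed element
    in A_y is small for y near x if the image at x is 0; applied to 1 - b c and
    1 - c b, where c represents the inverse at x, this makes b invertible in A_y
    for y near x by Neumann series ([invertible_spreads]).

    Lifting is where the order 2^m matters.  A homomorphism from the cone amounts
    to pairwise orthogonal positive contractions h_l, permuted by the
    translations.  For Z/2 the difference h_0 - h_1 is self-adjoint and odd; an
    arbitrary lift of it becomes self-adjoint and odd by averaging, and its
    positive and negative parts are orthogonal and exchanged by the generator.
    For Z/2^m one descends along the subgroups 2^d Z / 2^m Z: a lift D at stage
    d is multiplied by -1 by the odd multiples of 2^d, fixed by the multiples of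
    2^(d+1) and orthogonal to its remaining translates, so its positive part E
    is orthogonal to all translates outside 2^(d+1) Z; compressing by the
    fourth root of E a suitable lift X for the next subgroup gives stage d + 1
    ([dyadic_lift]).  After the last stage all the translates of the positive
    part of D are orthogonal, and f |-> sum_l alpha_l (f(D, l)) is the
    homomorphism sought.

    This rests on a continuous functional calculus for self-adjoint elements a
    with |a| < 2.  Functions are approximated uniformly on [-2, 2] by Bernstein
    polynomials ([weierstrass]), and the bound of |p(a)| by the supremum of |p|
    on [-2, 2] ([nrm_peval_le]) is elementary: a = u + u^-1 with u unitary, so
    p(a) is up to a unitary factor a polynomial in u, whose coefficients are
    bounded by Cauchy's estimate; the loss, linear in the degree, disappears by
    passing to high powers of p. *)

(** * Norms of algebra elements as real numbers *)

Section NormTools.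
Variables (R : realType) (A : cstarAlgType R).
Implicit Types (a b : A).

Lemma nrm_le a (r : R) : (nrm a <= r) = (`|a| <= r%:C%C).
Proof. by rewrite nrmE lecR. Qed.

Lemma nrm0 : nrm (0 : A) = 0.
Proof. by apply: complexI; rewrite -nrmE normr0. Qed.

Lemma nrm_eq0 a : nrm a <= 0 -> a = 0.
Proof.
by rewrite nrm_le => h; apply/eqP; rewrite -normr_le0.
Qed.

Lemma nrmB a b : nrm (a - b) = nrm (b - a).
Proof. by apply: complexI; rewrite -!nrmE distrC. Qed.

Lemma nrm_star a : nrm (star a) = nrm a.
Proof. by apply: complexI; rewrite -!nrmE normr_star. Qed.

Lemma nrm_star_mul a : nrm (star a * a) = nrm a ^+ 2.
Proof. by apply: complexI; rewrite rmorphXn /= -!nrmE normr_star_mul. Qed.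

Lemma nrmZ_le (c : R[i]) (r : R) a : `|c| <= r%:C%C -> nrm (c *: a) <= r * nrm a.
Proof.
by move=> h; rewrite nrm_le normrZ rmorphM /= -nrmE; apply: ler_wpM2r.
Qed.

Lemma nrm_sum (I : finType) (F : I -> A) : nrm (\sum_i F i) <= \sum_i nrm (F i).
Proof.
apply: (big_ind2 (fun x y => nrm x <= y)); first by rewrite nrm0.
- by move=> x1 y1 x2 y2 h1 h2; apply: le_trans (nrmD _ _) _; exact: lerD.
- by [].
Qed.

Lemma nrm1 : nrm (1 : A) <= 1.
Proof. by rewrite nrm_le ler_cnorm1. Qed.

Lemma nrmX_le a n : nrm a <= 1 -> nrm (a ^+ n) <= 1.
Proof.
move=> h; elim: n => [|n IH]; first by rewrite expr0 nrm1.
rewrite exprS; apply: le_trans (nrmM _ _) _; rewrite -[leRHS]mulr1.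
by apply: ler_pM; rewrite ?nrm_ge0.
Qed.

Lemma starX a n : star (a ^+ n) = star a ^+ n.
Proof.
elim: n => [|n IH]; first by rewrite !expr0 star1.
by rewrite exprS starMr IH -exprSr.
Qed.

Lemma star_sum (I : finType) (F : I -> A) : star (\sum_i F i) = \sum_i star (F i).
Proof. exact: (big_morph _ (@starD _ A) (star0 A)). Qed.

End NormTools.

(** * Polynomials evaluated at an algebra element *)

Section PolynomialCalculus.
Variables (R : realType) (A : cstarAlgType R).
Implicit Types (a b : A) (p q : {poly R[i]}).

(** An explicit sum, because the algebra may be zero while [horner_alg]
    evaluates in nontrivial rings. *)
Definition peval a p : A := \sum_(i < size p) p`_i *: a ^+ i.

Lemma pevalE n a p : (size p <= n)%N -> peval a p = \sum_(i < n) p`_i *: a ^+ i.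
Proof.
move=> pn; rewrite /peval (big_ord_widen n (fun i => p`_i *: a ^+ i) pn).
rewrite [RHS](bigID (fun i : 'I_n => (i < size p)%N)) /= [X in _ + X]big1 ?addr0//.
by move=> i; rewrite -leqNgt => h; rewrite nth_default// scale0r.
Qed.

Lemma pevalD a p q : peval a (p + q) = peval a p + peval a q.
Proof.
have h := size_polyD p q; pose n := maxn (size p) (size q).
rewrite (pevalE _ h) (pevalE (n := n) _ (leq_maxl _ _)).
rewrite (pevalE (n := n) _ (leq_maxr _ _)) -big_split; apply: eq_bigr => i _.
by rewrite coefD scalerDl.
Qed.

Lemma pevalZ a c p : peval a (c *: p) = c *: peval a p.
Proof.
rewrite (pevalE _ (size_scale_leq c p)) /peval scaler_sumr; apply: eq_bigr => i _.
by rewrite coefZ scalerA.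
Qed.

Lemma peval0 a : peval a 0 = 0.
Proof. by rewrite /peval size_poly0 big_ord0. Qed.

Lemma peval_sum (I : finType) a (F : I -> {poly R[i]}) :
  peval a (\sum_i F i) = \sum_i peval a (F i).
Proof. exact: (big_morph _ (pevalD a) (peval0 a)). Qed.

Lemma pevalN a p : peval a (- p) = - peval a p.
Proof. by rewrite -scaleN1r pevalZ scaleN1r. Qed.

Lemma pevalB a p q : peval a (p - q) = peval a p - peval a q.
Proof. by rewrite pevalD pevalN. Qed.

Lemma pevalC a c : peval a c%:P = c *: (1 : A).
Proof.
by rewrite (pevalE (n := 1) _ (size_polyC_leq1 c)) big_ord1 coefC eqxx expr0.
Qed.

Lemma peval1 a : peval a 1 = 1.
Proof. by rewrite -[1 in LHS]/(1%:P) pevalC scale1r. Qed.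

Lemma pevalMX a p : peval a (p * 'X) = peval a p * a.
Proof.
have h : (size (p * 'X)%R <= (size p).+1)%N.
  by apply: leq_trans (size_polyMleq _ _) _; rewrite size_polyX addn2.
rewrite (pevalE _ h) big_ord_recl coefMX eqxx scale0r add0r /peval mulr_suml.
apply: eq_bigr => i _; rewrite coefMX lift0 /= exprSr.
by rewrite cscalerAl.
Qed.

Lemma pevalX a : peval a 'X = a.
Proof. by rewrite -[X in peval _ X]mul1r pevalMX peval1 mul1r. Qed.

Lemma pevalM a p q : peval a (p * q) = peval a p * peval a q.
Proof.
elim/poly_ind: q => [|q c IH]; first by rewrite mulr0 peval0 mulr0.
rewrite mulrDr mulrA !pevalD !pevalMX IH mulrDr mulrA; congr (_ + _).
rewrite mulrC mul_polyC pevalZ pevalC -cscalerAr mulr1 //.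
Qed.

Lemma pevalXn a p n : peval a (p ^+ n) = peval a p ^+ n.
Proof.
by elim: n => [|n IH]; rewrite ?expr0 ?peval1// !exprS pevalM IH.
Qed.

Lemma peval_star a p : star a = a ->
  star (peval a p) = peval a (map_poly (fun z : R[i] => z^*) p).
Proof.
move=> sa; rewrite (pevalE (n := size p) _ (size_poly _ _)) star_sum.
apply: eq_bigr => i _; rewrite starZ starX sa coef_map_id0 ?conjC0 //.
Qed.

End PolynomialCalculus.

Lemma star_hom_peval (R : realType) (A B : cstarAlgType R) (f : A -> B)
    (a : A) (p : {poly R[i]}) : star_hom f ->
  f (peval a p) = peval (f a) p.
Proof.
move=> [fl [f1 fM] _].
have fD (b c : A) : f (b + c) = f b + f c.
  by have := fl 1 b c; rewrite !scale1r.
have f0 : f 0 = 0.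
  by have := fD 0 0; rewrite addr0 => /eqP; rewrite -subr_eq subrr => /eqP.
have fX n : f (a ^+ n) = f a ^+ n.
  by elim: n => [|n IH]; rewrite ?expr0// !exprS fM IH.
rewrite /peval (big_morph f fD f0); apply: eq_bigr => i _.
by have := fl p`_i (a ^+ i) 0; rewrite f0 !addr0 fX.
Qed.


(** * A norm bound for polynomials, linear in the degree *)

Section NormBound.
Variable R : realType.
Implicit Types (p q : {poly R[i]}).

(** The roots of X^n - 1 are distinct in characteristic 0, so there are n of
    them, and n distinct n-th roots of unity in a field include a primitive
    one. *)
Lemma prim_root_complex n : (0 < n)%N -> exists z : R[i], n.-primitive_root z.
Proof.
move=> n0; have [r rE] := closed_field_poly_normal ('X^n - 1 : {poly R[i]}).
rewrite (monicP _) ?monicXnsubC// scale1r in rE.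
have [|||z _ zn] := hasP (@has_prim_root _ n r n0 _ _ _); last by exists z.
- by apply/allP => z; rewrite -root_prod_XsubC -rE.
- by rewrite -separable_prod_XsubC -rE separable_Xn_sub_1// pnatr_eq0 -lt0n.
- by rewrite -ltnS -(size_prod_XsubC r id) -rE size_XnsubC.
Qed.

(** Cauchy's estimate in finite form: the coefficients of q are the discrete
    Fourier coefficients of its values at the n-th roots of unity, for n the
    number of coefficients. *)
Lemma coef_le_circle q (M : R) :
  (forall z : R[i], `|z| = 1 -> `|q.[z]| <= M%:C%C) ->
  forall j, `|q`_j| <= M%:C%C.
Proof.
move=> qM j; have [js|js] := ltnP j (size q); last first.
  by rewrite nth_default// normr0; apply: le_trans (qM 1 (normr1 _)).
pose n := size q; have n0 : (0 < n)%N by apply: leq_ltn_trans js.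
have [z zn] := prim_root_complex n0.
have nz : `|z| = 1.
  apply/eqP; rewrite -(@pexpr_eq1 _ _ n)// -normrX (prim_expr_order zn) normr1 //.
have z0 : z != 0 by rewrite -normr_gt0 nz.
(* Orthogonality of characters: only the term i = j survives the sum over k. *)
have key : \sum_(k < n) q.[z ^+ k] * z ^- (k * j) = n%:R * q`_j.
  under eq_bigr => k _ do rewrite horner_coef mulr_suml.
  rewrite exchange_big /= (bigD1 (Ordinal js)) //= [X in _ + X]big1 ?addr0.
    under eq_bigr => k _ do rewrite -exprM mulfK ?expf_neq0//.
    by rewrite sumr_const card_ord mulr_natl.
  move=> i /eqP ij.
  have ne : z ^+ i / z ^+ j - 1 != 0.
    rewrite subr_eq0; apply/eqP => /(congr1 (fun w => w * z ^+ j)).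
    rewrite mul1r divfK ?expf_neq0// => /eqP; rewrite (eq_prim_root_expr zn).
    by rewrite /eqn !modn_small// => /eqP e; apply: ij; apply: val_inj.
  under eq_bigr => k _ do rewrite -mulrA exprAC mulnC exprM -exprVn -exprMn.
  rewrite -mulr_sumr; have := subrX1 (z ^+ i / z ^+ j) n.
  rewrite exprMn exprVn -!exprM ![(_ * n)%N]mulnC !exprM (prim_expr_order zn).
  rewrite !expr1n invr1 mulr1 subrr => /esym/eqP; rewrite mulf_eq0 (negbTE ne) /=.
  by move=> /eqP ->; rewrite mulr0.
have : n%:R * `|q`_j| <= n%:R * M%:C%C.
  rewrite -[n%:R in leLHS]normr_nat -normrM -key.
  apply: le_trans (ler_norm_sum _ _ _) _.
  apply: (@le_trans _ _ (\sum_(k < n) M%:C%C)); last first.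
    by rewrite sumr_const card_ord mulr_natl.
  apply: ler_sum => k _; rewrite normrM normfV normrX nz expr1n invr1 mulr1.
  by apply: qM; rewrite normrX nz expr1n.
by rewrite ler_pM2l// ltr0n.
Qed.

Variable A : cstarAlgType R.
Implicit Types (a u : A).

Lemma nrm_peval_unitary u q (M : R) : nrm u <= 1 ->
  (forall z : R[i], `|z| = 1 -> `|q.[z]| <= M%:C%C) ->
  nrm (peval u q) <= (size q)%:R * M.
Proof.
move=> u1 qM; apply: le_trans (nrm_sum _) _.
apply: (@le_trans _ _ (\sum_(i < size q) M)); last first.
  by rewrite sumr_const card_ord mulr_natl.
apply: ler_sum => i _; apply: le_trans (nrmZ_le _ (coef_le_circle qM i)) _.
rewrite -[leRHS]mulr1; apply: ler_wpM2l; last exact: nrmX_le.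
by rewrite -ler0c; apply: le_trans (qM 1 (normr1 _)).
Qed.

(** With h = a / 2 and k = sqrt (1 - h^2) the unitary is h + i k, as in
    2 cos x = exp (i x) + exp (- i x).  The strict bound 2 is what makes the
    square root available; it is also why [-2, 2] is the interval on which
    functions are compared below. *)
Lemma unitary_split a : star a = a -> nrm a < 2 ->
  exists u : A, [/\ star u * u = 1, u * star u = 1 & a = u + star u].
Proof.
move=> sa a2; pose h := 2^-1 *: a.
have sh : star h = h by rewrite starZ sa fmorphV rmorph_nat.
have h1 : nrm h < 1.
  apply: le_lt_trans (@nrmZ_le _ _ _ 2^-1 _ _) _.
    by rewrite ger0_norm ?invr_ge0 ?ler0n// fmorphV rmorph_nat.
  by rewrite mulrC ltr_pdivrMr// mul1r.
have hh : a = h + h.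
  have e : 2^-1 + 2^-1 = 1 :> R[i] by field.
  by rewrite /h -scalerDl e scale1r.
clearbody h; have [k [sk kh hk]] := cstar_sqrt sh h1.
exists (h + 'i *: k).
have -> : star (h + 'i *: k) = h - 'i *: k.
  by rewrite starD starZ sh sk conjCi scaleNr.
split.
- rewrite mulrDr !mulrBl -!cscalerAl -!cscalerAr scalerA -(expr2 'i) sqrCi.
  by rewrite scaleN1r opprK kh addrA subrK.
- rewrite mulrBr !mulrDl -!cscalerAl -!cscalerAr scalerA -(expr2 'i) sqrCi.
  by rewrite scaleN1r kh opprD opprK addrA addrK.
- by rewrite addrACA subrr addr0.
Qed.

(** Quantification over [-2, 2], the image of the unit circle under
    z |-> z + 1 / z. *)
Definition on_interval (P : R -> Prop) := forall t : R, `|t| <= 2 -> P t.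

(** For a = u + u^-1 with u unitary, u^n p(a) is the value at u of the
    polynomial q(z) = z^n p(z + 1 / z), and |q| <= M on the unit circle, because
    z + 1 / z is there a point of [-2, 2].  Bounding each coefficient of q by M
    loses a factor that is only linear in the degree. *)
Lemma nrm_peval_crude a p (M : R) : star a = a -> nrm a < 2 ->
  on_interval (fun t => `|p.[t%:C%C]| <= M%:C%C) ->
  nrm (peval a p) <= ((size p).*2.+1)%:R * M.
Proof.
move=> sa a2 pM; have [u [uu uu' au]] := unitary_split sa a2.
pose n := size p.
pose q : {poly R[i]} := \sum_(i < n) p`_i *: (('X ^+ 2 + 1) ^+ i * 'X ^+ (n - i)).
have M0 : 0 <= M.
  by rewrite -ler0c; apply: le_trans (pM 0 _); rewrite ?normr0.
have nu : nrm u <= 1.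
  rewrite -(@ler_pXn2r _ 2) ?nnegrE ?nrm_ge0// -nrm_star_mul uu expr1n; exact: nrm1.
have qz z : `|z| = 1 -> `|q.[z]| <= M%:C%C.
  move=> z1; have z0 : z != 0 by rewrite -normr_gt0 z1.
  have zJ : z^-1 = z^* by rewrite invC_norm z1 expr1n invr1 mul1r.
  have -> : q.[z] = p.[z + z^*] * z ^+ n.
    rewrite /q horner_sum horner_coef mulr_suml; apply: eq_bigr => i _.
    rewrite !hornerE /=.
    have -> : z ^+ n = z ^+ i * z ^+ (n - i) by rewrite -exprD subnKC// ltnW.
    rewrite -!mulrA; congr (_ * _); rewrite mulrA; congr (_ * _).
    by rewrite -exprMn mulrDl -zJ mulVf// -expr2.
  rewrite normrM normrX z1 expr1n mulr1.
  case: z z1 {z0 zJ} => x y z1.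
  have -> : ((x +i* y)%C + ((x +i* y)%C)^* = (x + x)%:C%C).
    by apply/eqP; rewrite eq_complex /= subrr !eqxx.
  apply: pM.
  have x1 : `|x| <= 1.
    rewrite -(@lecR R); apply: le_trans (normc_ge_Re (x +i* y)%C) _.
    by rewrite z1.
  by apply: le_trans (ler_normD _ _) _;
    apply: (@le_trans _ _ (1 + 1)); rewrite ?lerD// -(natrD _ 1 1).
have qu : peval u q = peval a p * u ^+ n.
  rewrite /q peval_sum /peval mulr_suml; apply: eq_bigr => i _.
  rewrite -/(peval _ _) pevalZ pevalM !pevalXn pevalD pevalXn peval1 pevalX.
  rewrite -cscalerAl; congr (_ *: _).
  have -> : u ^+ n = u ^+ i * u ^+ (n - i) by rewrite -exprD subnKC// ltnW.
  rewrite mulrA; congr (_ * _).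
  have -> : u ^+ 2 + 1 = a * u by rewrite au mulrDl uu expr2.
  apply: exprMn_comm; rewrite /GRing.comm au mulrDl mulrDr; congr (_ + _).
  by rewrite uu uu'.
have pq : peval a p = peval u q * star u ^+ n.
  rewrite qu -mulrA; suff -> : u ^+ n * star u ^+ n = 1 by rewrite mulr1.
  by rewrite -exprMn_comm ?uu' ?expr1n// /GRing.comm uu uu'.
rewrite pq; apply: le_trans (nrmM _ _) _.
rewrite -[leRHS]mulr1; apply: ler_pM; rewrite ?nrm_ge0//; last first.
  by rewrite -starX nrm_star nrmX_le.
apply: le_trans (nrm_peval_unitary nu qz) _; apply: ler_wpM2r => //.
rewrite ler_nat; apply: leq_trans (size_sum _ _ _) _.
apply/bigmax_leqP => i _; apply: leq_trans (size_scale_leq _ _) _.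
apply: leq_trans (size_polyMleq _ _) _; rewrite size_polyXn addnS /=.
have : (size (('X ^+ 2 + 1 : {poly R[i]}) ^+ i)%R <= (i.*2).+1)%N.
  apply: leq_trans (size_poly_exp_leq _ _) _.
  rewrite ltnS -[1 : {poly _}]/(1%:P) size_XnaddC//= -muln2 mulnC//.
have aux (x y z : nat) : (z < y -> x <= z.*2.+1 -> x + (y - z) <= y.*2.+1)%N by lia.
exact: aux.
Qed.

End NormBound.

(** * The norm of a polynomial in a self-adjoint element *)

Section SharpBound.
Variable R : realType.

Lemma bernoulli_ineq (d : R) n : 0 <= d -> 1 + n%:R * d <= (1 + d) ^+ n.
Proof.
move=> d0; elim: n => [|n IH]; first by rewrite mul0r addr0 expr0.
rewrite exprS -natr1 mulrDl mul1r.
apply: (@le_trans _ _ ((1 + d) * (1 + n%:R * d))); last first.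
  by apply: ler_wpM2l => //; rewrite addr_ge0.
have : 0 <= n%:R * d * d by rewrite !mulr_ge0.
by set z := n%:R; nra.
Qed.

(** The power trick: the ratio x / y has powers growing at most linearly in the
    exponent, so it cannot exceed 1. *)
Lemma le_of_pow2_bound (x y C : R) : 0 <= x -> 0 <= y ->
  (forall s, x ^+ (2 ^ s) <= C * (2 ^ s)%:R * y ^+ (2 ^ s)) -> x <= y.
Proof.
move=> x0 y0 h; rewrite leNgt; apply/negP => yx.
have xp : 0 < x by exact: le_lt_trans yx.
have [y00|yn0] := eqVneq y 0.
  by have := h 0%N; rewrite y00 !expr1 mulr0 leNgt xp.
have yp : 0 < y by rewrite lt_def yn0.
(* With x / y = 1 + d, Bernoulli's inequality at exponent N = 2^s, squared,
   gives N^2 d^2 <= (x / y)^(2 N) <= 2 C N, which fails once N > 2 C / d^2. *)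
pose d := x / y - 1; have d0 : 0 < d by rewrite subr_gt0 ltr_pdivlMr// mul1r.
have rs s : (1 + d) ^+ (2 ^ s) <= C * (2 ^ s)%:R.
  by rewrite /d addrC subrK expr_div_n ler_pdivrMr ?exprn_gt0.
have C0 : 0 <= C.
  by have := rs 0%N; rewrite expr1 mulr1; apply: le_trans; rewrite addr_ge0// ltW.
pose s := Num.truncn (2 * C / (d * d)).
have sP : 2 * C / (d * d) < (2 ^ s)%:R.
  apply: lt_le_trans (truncnS_gt _) _; rewrite ler_nat -/s.
  exact: ltn_expl.
have := rs s.+1; rewrite expnS mulnC exprM natrM leNgt => /negP; apply.
apply: lt_le_trans (_ : (1 + (2 ^ s)%:R * d) ^+ 2 <= _); last first.
  rewrite ler_pXn2r ?nnegrE//.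
  - exact: bernoulli_ineq (ltW d0).
  - by rewrite addr_ge0// mulr_ge0// ltW.
  - by rewrite exprn_ge0// addr_ge0// ltW.
set N := (2 ^ s)%:R in sP *.
have N0 : 0 <= N by rewrite ler0n.
have : 2 * C < N * (d * d) by rewrite -ltr_pdivrMr// mulr_gt0.
have : 0 <= N * d by rewrite mulr_ge0// ltW.
have -> : (1 + N * d) ^+ 2 = 1 + 2 * (N * d) + N * (N * (d * d)) by ring.
move=> h1 h2.
have : N * (2 * C) <= N * (N * (d * d)) by apply: ler_wpM2l => //; exact: ltW.
lra.
Qed.

Variable A : cstarAlgType R.
Implicit Types (a : A) (p : {poly R[i]}).

(** The C*-identity for a self-adjoint element reads |a^2| = |a|^2. *)
Lemma nrm_sa_pow2 a s : star a = a -> nrm (a ^+ (2 ^ s)) = nrm a ^+ (2 ^ s).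
Proof.
move=> sa; elim: s => [|s IH]; first by rewrite !expr1.
by rewrite expnSr !exprM -IH expr2 -{1}sa -starX nrm_star_mul.
Qed.

(** The crude bound applied to all the powers [(p^* p)^(2^s)] has linear loss,
    while the norm of [(p^* p)(a)] is multiplicative along these powers; the
    power trick removes the loss. *)
Lemma nrm_peval_le a p (M : R) : star a = a -> nrm a < 2 ->
  on_interval (fun t => `|p.[t%:C%C]| <= M%:C%C) -> nrm (peval a p) <= M.
Proof.
move=> sa a2 pM.
have M0 : 0 <= M by rewrite -ler0c; apply: le_trans (pM 0 _); rewrite ?normr0.
rewrite -(@ler_pXn2r _ 2) ?nnegrE ?nrm_ge0// -nrm_star_mul (peval_star _ sa) -pevalM.
(* From here on q is the polynomial p^* p, and q(a) is self-adjoint. *)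
set q := _ * p.
have sq : star (peval a q) = peval a q.
  by rewrite /q pevalM starMr -(peval_star _ sa) starK.
have qM t : `|t| <= 2 -> `|q.[t%:C%C]| <= (M ^+ 2)%:C%C.
  move=> t2; rewrite hornerM normrM.
  have -> : (map_poly (fun z : R[i] => z^*) p).[t%:C%C] = (p.[t%:C%C])^*.
    have {1}-> : t%:C%C = (t%:C%C)^* by apply/eqP; rewrite eq_complex /= oppr0 !eqxx.
    exact: horner_map.
  by rewrite norm_conjC rmorphXn expr2; apply: ler_pM => //; exact: pM.
apply: (@le_of_pow2_bound _ _ ((2 * size q + 3)%N%:R)); rewrite ?nrm_ge0 ?exprn_ge0// => s.
rewrite -nrm_sa_pow2// -pevalXn.
apply: le_trans (nrm_peval_crude (M := (M ^+ 2) ^+ (2 ^ s)) sa a2 _) _.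
  move=> t t2; rewrite horner_exp normrX [(_ ^+ (2 ^ s))%:C%C]rmorphXn /=.
  by rewrite ler_pXn2r ?nnegrE ?qM// ?ler0c ?exprn_ge0// expn_gt0.
apply: ler_wpM2r; first by rewrite !exprn_ge0.
rewrite -natrM ler_nat.
have := size_poly_exp_leq q (2 ^ s); have : (0 < 2 ^ s)%N by rewrite expn_gt0.
set x := size _; set N := (2 ^ s)%N; move: (size q) => z N1 xz.
have zN : (z.-1 * N <= z * N)%N by rewrite leq_mul2r leq_pred orbT.
have : (x.*2.+1 <= (z * N).*2 + 3 * N)%N.
  rewrite -!addnn; lia.
move=> h; apply: leq_trans h _; rewrite mulnDl -muln2 mulnC mulnA leqnn//.
Qed.

End SharpBound.

(** * Uniform approximation by polynomials *)

Section Weierstrass.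
Variable R : realType.
Implicit Types (g : nat -> R[i]).

(** The Bernstein polynomial of the values g 0, ..., g n, in the form of the
    expectation of g at the number of successes in n independent trials of
    probability X; the recursion conditions on the first trial, so that no
    binomial coefficient appears. *)
Fixpoint bernstein n g : {poly R[i]} :=
  if n is m.+1 then 'X * bernstein m (g \o S) + (1 - 'X) * bernstein m g
  else (g 0%N)%:P.

(** The number of successes has variance n x (1 - x), which gives its mean
    square distance to c; a bound of |g - w| that is quadratic in that distance
    passes to the expectation.  A general c is needed because conditioning on
    the first trial shifts it. *)
Lemma bernstein_approx n g (w : R[i]) (x a b c : R) : 0 <= x <= 1 ->
  (forall k, (k <= n)%N -> `|g k - w| <= (a + b * (k%:R - c) ^+ 2)%:C%C) ->
  `|(bernstein n g).[x%:C%C] - w| <=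
    (a + b * ((n%:R * x - c) ^+ 2 + n%:R * x * (1 - x)))%:C%C.
Proof.
move=> /andP[x0 x1]; elim: n g c => [|n IH] g c h /=.
  rewrite hornerC !mul0r addr0; exact: h.
rewrite !(hornerD, hornerM, hornerN, hornerX) hornerC.
set u := (bernstein n (g \o S)).[_]; set v := (bernstein n g).[_].
have -> : x%:C%C * u + (1 - x%:C%C) * v - w =
    x%:C%C * (u - w) + (1 - x%:C%C) * (v - w) by ring.
apply: le_trans (ler_normD _ _) _; rewrite !normrM.
have -> : `|x%:C%C| = x%:C%C by rewrite ger0_norm// ler0c.
have -> : `|1 - x%:C%C| = (1 - x)%:C%C.
  have -> : 1 - x%:C%C = (1 - x)%:C%C by rewrite (rmorphB (real_complex R)).
  by rewrite ger0_norm// ler0c subr_ge0.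
have hu : `|u - w| <= (a + b * ((n%:R * x - (c - 1)) ^+ 2 + n%:R * x * (1 - x)))%:C%C.
  by apply: IH => k kn; have := h k.+1 kn; rewrite -natr1 opprB addrA.
have hv : `|v - w| <= (a + b * ((n%:R * x - c) ^+ 2 + n%:R * x * (1 - x)))%:C%C.
  by apply: IH => k kn; apply: h; exact: leqW.
have x0C : 0 <= x%:C%C by rewrite ler0c.
have x1C : 0 <= (1 - x)%:C%C by rewrite ler0c subr_ge0.
apply: le_trans (lerD (ler_wpM2l x0C hu) (ler_wpM2l x1C hv)) _.
rewrite -!rmorphM -rmorphD lecR -natr1 /= le_eqVlt; apply/orP; left; apply/eqP; ring.
Qed.

(** Uniform continuity and boundedness in one inequality, the form in which
    Chebyshev's argument uses them.  Near a point of the diagonal of the square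
    [-2, 2] x [-2, 2] the term e suffices; near any other point (s - t)^2 is
    bounded below and a large K suffices.  Compactness makes K uniform. *)
Lemma quadratic_modulus (f : R -> R[i]) (e : R) : continuous f -> 0 < e ->
  exists2 K : R, 0 <= K & forall s t, `|s| <= 2 -> `|t| <= 2 ->
    `|f s - f t| <= (e + K * (s - t) ^+ 2)%:C%C.
Proof.
move=> cf e0.
pose I : set R := `[(-2), 2]%classic.
have IE (s : R) : I s <-> `|s| <= 2 by rewrite /I /= in_itv /= ler_norml.
have cI : compact (I `*` I) by apply: compact_setX; exact: segment_compact.
pose P (n : nat) (z : R * R) := `|f z.1 - f z.2| <= (e + n%:R * (z.1 - z.2) ^+ 2)%:C%C.
have /compact_near_coveringP/(_ nat \oo P _) := cI.
have cg : continuous (fun z : R * R => f z.1 - f z.2).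
  move=> z; apply: cvgB; apply: continuous_comp;
    [exact: cvg_fst|exact: cf|exact: cvg_snd|exact: cf].
have cs : continuous (fun z : R * R => (z.1 - z.2) ^+ 2).
  move=> z; apply: cvgM; apply: cvgB; [exact: cvg_fst|exact: cvg_snd|exact: cvg_fst|exact: cvg_snd].
move=> []; last first.
  move=> N _ /(_ N (leqnn N)) h; exists N%:R => // s t /IE Is /IE It.
  exact: (h (s, t)).
move=> [s t] _.
have [st|st] := eqVneq s t.
  have eC : 0 < e%:C%C by rewrite (ltcR 0).
  have := cg (s, t) => /cvgrPdist_lt /(_ _ eC) h.
  exists ([set z | `|(f s - f t) - (f z.1 - f z.2)| < e%:C%C], setT) => /=.
    by split; [exact: h|exact: filterT].
  move=> [z n] /= [+ _]; rewrite st subrr sub0r normrN => /ltW zs.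
  by apply: le_trans zs _; rewrite lecR lerDl mulr_ge0// sqr_ge0.
have d0 : 0 < (s - t) ^+ 2 by rewrite exprn_even_gt0// subr_eq0.
pose d := (s - t) ^+ 2 / 2; have dp : 0 < d by rewrite divr_gt0.
have := cg (s, t) => /cvgrPdist_lt /(_ _ ltr01) h1.
have := cs (s, t) => /cvgrPdist_lt /(_ _ dp) h2.
have [r rE] : exists r, `|f s - f t| = r%:C%C.
  have := normr_ge0 (f s - f t).
  by case: `|_| => r i; rewrite lecE /= => /andP[/eqP -> _]; exists r.
exists ([set z | `|(f s - f t) - (f z.1 - f z.2)| < 1 /\
   `|(s - t) ^+ 2 - (z.1 - z.2) ^+ 2| < d],
   [set n | (Num.truncn ((r + 1) / d) < n)%N]) => /=.
  split; first exact: filterI.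
  by exists (Num.truncn ((r + 1) / d)).+1.
move=> [z n] /= [[z1 z2] hn].
have dn : (r + 1) / d < n%:R.
  by apply: lt_le_trans (truncnS_gt _) _; rewrite ler_nat.
have zd : d < (z.1 - z.2) ^+ 2.
  move: z2; rewrite ltr_norml => /andP[_].
  rewrite {1}(splitr ((s - t) ^+ 2)) -/d; lra.
have r0 : 0 <= r by rewrite -ler0c -rE.
rewrite /P -(subKr (f s - f t) (f z.1 - f z.2)).
apply: le_trans (ler_normB _ _) _; rewrite rE.
apply: (@le_trans _ _ (r + 1)%:C%C).
  by rewrite rmorphD lerD2l ltW.
rewrite lecR; apply: (@le_trans _ _ (n%:R * (z.1 - z.2) ^+ 2)); last first.
  by rewrite lerDr ltW.
move: dn; rewrite ltr_pdivrMr// => /ltW dn; apply: le_trans dn _.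
by apply: ler_wpM2l => //; exact: ltW.
Qed.

(** The variable t of [-2, 2] is 4 x - 2 with x in [0, 1], sampled at the
    points k / n. *)
Lemma weierstrass (f : R -> R[i]) (e : R) : continuous f -> 0 < e ->
  exists p : {poly R[i]},
    on_interval (fun t => `|p.[t%:C%C] - f t| <= e%:C%C).
Proof.
move=> cf e0; have e2 : 0 < e / 2 by rewrite divr_gt0.
have [K K0 fK] := quadratic_modulus cf e2.
pose n := (Num.truncn (16 * K / (e / 2))).+1.
have nR : 0 < n%:R :> R by rewrite ltr0n.
have nK : 16 * K / n%:R <= e / 2.
  rewrite ler_pdivrMr// [leRHS]mulrC -ler_pdivrMr//; exact: ltW (truncnS_gt _).
clearbody n; pose g (k : nat) := f (4 * k%:R / n%:R - 2).
exists (bernstein n g \Po (4^-1 *: ('X + 2%:P))) => t t2.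
pose x := (t + 2) / 4.
have x01 : 0 <= x <= 1.
  by move: t2; rewrite ler_norml /x => /andP[h1 h2]; apply/andP; split; lra.
have -> : (bernstein n g \Po (4^-1 *: ('X + 2%:P))).[t%:C%C] = (bernstein n g).[x%:C%C].
  rewrite horner_comp; congr (_.[_]); rewrite hornerZ hornerD hornerX hornerC.
  by rewrite /x mulrC (rmorphM (real_complex R)) (fmorphV (real_complex R))
    (rmorphD (real_complex R)) !(rmorph_nat (real_complex R)).
apply: le_trans (@bernstein_approx n g (f t) x (e / 2) (16 * K / n%:R ^+ 2) (n%:R * x) x01 _) _.
  move=> k kn; apply: le_trans (fK _ _ _ t2) _.
    rewrite ler_norml; apply/andP; split.
      by rewrite lerBrDr addNr divr_ge0// mulr_ge0.
    rewrite lerBlDr ler_pdivrMr// -natrD; apply: ler_wpM2l; rewrite ?ler0n//.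
    by rewrite ler_nat.
  rewrite lecR lerD2l le_eqVlt; apply/orP; left; apply/eqP.
  rewrite /x; field; exact: lt0r_neq0.
rewrite lecR [leRHS]splitr lerD2l subrr expr0n /= add0r.
apply: le_trans nK; have := x01 => /andP[x0 x1].
have -> : 16 * K / n%:R ^+ 2 * (n%:R * x * (1 - x)) = 16 * K / n%:R * (x * (1 - x)).
  by field; exact: lt0r_neq0.
rewrite -[leRHS]mulr1; apply: ler_wpM2l; first by rewrite divr_ge0// mulr_ge0.
by rewrite -[leRHS]mulr1; apply: ler_pM => //; rewrite ?subr_ge0// lerBlDr lerDl.
Qed.

End Weierstrass.

(** * Continuous functional calculus for self-adjoint elements *)

Section FunctionalCalculus.
Variable R : realType.
Implicit Types (f g : R -> R[i]) (p q : {poly R[i]}).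

Lemma norm_realE (z : R[i]) : exists2 r : R, 0 <= r & `|z| = r%:C%C.
Proof.
have := normr_ge0 z; case: `|z| => r i; rewrite lecE /= => /andP[/eqP -> r0].
by exists r.
Qed.

Lemma interval_bounded f : continuous f ->
  exists2 M : R, 0 <= M & on_interval (fun t => `|f t| <= M%:C%C).
Proof.
move=> cf; have [K K0 fK] := quadratic_modulus cf ltr01.
have [r r0 rE] := norm_realE (f 0).
exists (r + (1 + K * 4)); first by rewrite !addr_ge0// mulr_ge0.
move=> t t2; rewrite -(subrK (f 0) (f t)) addrC.
apply: le_trans (ler_normD _ _) _; rewrite rE (rmorphD (real_complex R)) lerD2l.
apply: le_trans (fK _ _ t2 _) _; rewrite ?normr0// lecR lerD2l subr0.
apply: ler_wpM2l => //; rewrite -real_normK ?num_real//.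
have := normr_ge0 t; nra.
Qed.

Section OneAlgebra.
Variable A : cstarAlgType R.
Implicit Types (a b x y z : A).

Definition self_adjoint_lt2 a := star a = a /\ nrm a < 2.

(** y = f(a): y is approximated by the values at a of polynomials that are
    uniformly close to f on [-2, 2].  Working with this relation rather than
    with chosen approximations makes every algebraic property of the calculus a
    statement about polynomials. *)
Definition is_fc a f y := forall e : R, 0 < e -> exists p,
  on_interval (fun t => `|p.[t%:C%C] - f t| <= e%:C%C) /\ nrm (peval a p - y) <= e.

Lemma nrm_small0 x (C : R) : 0 <= C -> (forall e, 0 < e -> nrm x <= e * C) -> x = 0.
Proof.
move=> C0 h; apply: nrm_eq0; rewrite leNgt; apply/negP => x0.
have C1 : 0 < C + 1 by rewrite ltr_wpDl.
have := h (nrm x / (C + 1)) (divr_gt0 x0 C1).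
rewrite mulrAC ler_pdivlMr// ler_pM2l// => h1; lra.
Qed.

Lemma is_fc_norm a f y (M : R) : self_adjoint_lt2 a -> is_fc a f y ->
  on_interval (fun t => `|f t| <= M%:C%C) -> nrm y <= M.
Proof.
move=> [sa a2] fy fM; apply/ler_addgt0Pr => e e0.
have e2 : 0 < e / 2 by rewrite divr_gt0.
have [p [pf py]] := fy _ e2.
have : nrm (peval a p) <= M + e / 2.
  apply: nrm_peval_le => // t t2; rewrite -(subrK (f t) _.[_]) addrC.
  apply: le_trans (ler_normD _ _) _; rewrite (rmorphD (real_complex R)).
  by apply: lerD; [exact: fM|exact: pf].
move=> h; rewrite -(subrK (peval a p) y); apply: le_trans (nrmD _ _) _.
rewrite nrmB; lra.
Qed.

Lemma is_fc_lin a c f g y z : is_fc a f y -> is_fc a g z ->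
  is_fc a (fun t => c * f t + g t) (c *: y + z).
Proof.
move=> fy gz e e0; have [r r0 rE] := norm_realE c.
have r1 : 0 < r + 1 by rewrite ltr_wpDl.
have d0 : 0 < e / (r + 1) by rewrite divr_gt0.
have [p [pf py]] := fy _ d0; have [q [qg qz]] := gz _ d0.
have de : r * (e / (r + 1)) + e / (r + 1) = e by field; exact: lt0r_neq0.
exists (c *: p + q); split=> [t t2|].
  rewrite hornerD hornerZ opprD addrACA -mulrBr -de.
  apply: le_trans (ler_normD _ _) _; rewrite normrM rE.
  rewrite (rmorphD (real_complex R)) (rmorphM (real_complex R)).
  by apply: lerD; [apply: ler_wpM2l; rewrite ?ler0c//; exact: pf|exact: qg].
rewrite pevalD pevalZ opprD addrACA -scalerBr -[leRHS]de.
apply: le_trans (nrmD _ _) _; apply: lerD => //.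
apply: le_trans (@nrmZ_le _ _ _ r _ _) _; first by rewrite rE.
exact: ler_wpM2l.
Qed.

Lemma is_fc_star a f y : star a = a -> is_fc a f y ->
  is_fc a (fun t => (f t)^*) (star y).
Proof.
move=> sa fy e e0; have [p [pf py]] := fy _ e0.
exists (map_poly (fun z : R[i] => z^*) p); split=> [t t2|].
  have -> : t%:C%C = (t%:C%C)^* by apply/eqP; rewrite eq_complex /= oppr0 !eqxx.
  rewrite (horner_map (Num.conj : {rmorphism R[i] -> R[i]})) -rmorphB norm_conjC.
  exact: pf.
by rewrite -peval_star// -starN -starD nrm_star.
Qed.

Lemma nrm_mul_approx x y z w (d : R) : nrm (x - y) <= d -> nrm (z - w) <= d -> d <= 1 ->
  nrm (x * z - y * w) <= d * (1 + nrm y + nrm w).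
Proof.
move=> xy zw d1.
have -> : x * z - y * w = (x - y) * (z - w) + ((x - y) * w + y * (z - w)).
  by rewrite addrA -mulrDr subrK mulrBl mulrBr addrA subrK.
apply: le_trans (nrmD _ _) _; apply: le_trans (lerD (lexx _) (nrmD _ _)) _.
have h1 : nrm ((x - y) * (z - w)) <= d * 1.
  apply: le_trans (nrmM _ _) _; apply: ler_pM; rewrite ?nrm_ge0//.
  exact: le_trans zw d1.
have h2 : nrm ((x - y) * w) <= d * nrm w.
  by apply: le_trans (nrmM _ _) _; apply: ler_wpM2r; rewrite ?nrm_ge0.
have h3 : nrm (y * (z - w)) <= nrm y * d.
  by apply: le_trans (nrmM _ _) _; apply: ler_wpM2l; rewrite ?nrm_ge0.
by apply: le_trans (lerD h1 (lerD h2 h3)) _; lra.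
Qed.

Lemma norm_mul_approx (x y z w : R[i]) (d F G : R) :
  `|x - y| <= d%:C%C -> `|z - w| <= d%:C%C -> d <= 1 ->
  `|y| <= F%:C%C -> `|w| <= G%:C%C ->
  `|x * z - y * w| <= (d * (1 + F + G))%:C%C.
Proof.
move=> xy zw d1 yF wG.
have -> : x * z - y * w = (x - y) * (z - w) + ((x - y) * w + y * (z - w)) by ring.
apply: le_trans (ler_normD _ _) _; apply: le_trans (lerD (lexx _) (ler_normD _ _)) _.
rewrite !normrM.
have h1 : `|x - y| * `|z - w| <= (d * 1)%:C%C.
  rewrite (rmorphM (real_complex R)); apply: ler_pM => //.
  by apply: le_trans zw _; rewrite lecR.
have h2 : `|x - y| * `|w| <= (d * G)%:C%C.
  by rewrite (rmorphM (real_complex R)); apply: ler_pM.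
have h3 : `|y| * `|z - w| <= (F * d)%:C%C.
  by rewrite (rmorphM (real_complex R)); apply: ler_pM.
apply: le_trans (lerD h1 (lerD h2 h3)) _.
rewrite -!(rmorphD (real_complex R)) lecR; lra.
Qed.

Lemma is_fcM a f g y z : continuous f -> continuous g ->
  is_fc a f y -> is_fc a g z -> is_fc a (fun t => f t * g t) (y * z).
Proof.
move=> cf cg fy gz e e0.
have [F F0 fF] := interval_bounded cf; have [G G0 gG] := interval_bounded cg.
have y0 := nrm_ge0 y; have z0 := nrm_ge0 z.
(* L dominates the constants of both product estimates. *)
pose L := 1 + (F + G + (nrm y + nrm z)).
have L0 : 0 < L by rewrite ltr_pwDl// !addr_ge0.
pose d := Num.min 1 (e / L).
have d0 : 0 < d by rewrite lt_min ltr01 divr_gt0.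
have d1 : d <= 1 by rewrite ge_min lexx.
have dL : d * L <= e by rewrite -ler_pdivlMr// ge_min lexx orbT.
have dle (u : R) : u <= L -> d * u <= e.
  by move=> uL; apply: le_trans dL; apply: ler_wpM2l => //; exact: ltW.
have [p [pf py]] := fy _ d0; have [q [qg qz]] := gz _ d0.
exists (p * q); split=> [t t2|].
  rewrite hornerM.
  apply: le_trans (norm_mul_approx (pf t t2) (qg t t2) d1 (fF t t2) (gG t t2)) _.
  by rewrite lecR; apply: dle; rewrite /L; lra.
rewrite pevalM; apply: le_trans (nrm_mul_approx py qz d1) _.
by apply: dle; rewrite /L; lra.
Qed.

Lemma is_fc_ext a f g y : on_interval (fun t => f t = g t) ->
  is_fc a f y -> is_fc a g y.
Proof.
move=> fg fy e e0; have [p [pf py]] := fy _ e0; exists p; split=> // t t2.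
by rewrite -fg//; exact: pf.
Qed.

(** The sup norm bound applied to the zero function f - f. *)
Lemma is_fc_unique a f y z : self_adjoint_lt2 a -> is_fc a f y -> is_fc a f z -> y = z.
Proof.
move=> ha fy fz; apply/eqP; rewrite -subr_eq0; apply/eqP; apply: nrm_eq0.
have := is_fc_lin (-1) fy fz; rewrite scaleN1r => h.
rewrite nrmB addrC; apply: is_fc_norm ha h _ => t _.
by rewrite mulN1r addNr normr0.
Qed.

(** The values at a of polynomials converging geometrically fast to f form a
    Cauchy sequence by the sup norm bound. *)
Lemma is_fc_ex a f : self_adjoint_lt2 a -> continuous f -> exists y, is_fc a f y.
Proof.
move=> [sa a2] cf.
have h0 : 0 < 2^-1 :> R by rewrite invr_gt0.
have /choice[p pP] : forall n : nat, exists p,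
    on_interval (fun t => `|p.[t%:C%C] - f t| <= ((2^-1) ^+ n.+2)%:C%C).
  by move=> n; apply: weierstrass => //; exact: exprn_gt0.
have pS n m : on_interval (fun t =>
    `|(p n - p m).[t%:C%C]| <= ((2^-1) ^+ n.+2 + (2^-1) ^+ m.+2)%:C%C).
  move=> t t2; rewrite hornerD hornerN.
  have -> : (p n).[t%:C%C] - (p m).[t%:C%C] =
    ((p n).[t%:C%C] - f t) - ((p m).[t%:C%C] - f t) by ring.
  apply: le_trans (ler_normB _ _) _; rewrite (rmorphD (real_complex R)).
  by apply: lerD; exact: pP.
have : cvg ((fun n => peval a (p n)) @ \oo).
  apply: (@geometric_cvg _ _ _ 2^-1).
    by rewrite ltW//= invf_lt1// ltr1n.
  move=> n; rewrite -pevalB; apply: le_trans (nrm_peval_le sa a2 (pS _ _)) _.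
  have : 0 <= (2^-1 : R) ^+ n by rewrite exprn_ge0// ltW.
  rewrite !exprS; set z := _ ^+ n; lra.
move=> /cvg_ex[y /cvgrPdist_le py]; exists y => e e0.
have e1 : 0 < e%:C%C by rewrite (ltcR 0).
have [N1 _ h1] := py _ e1; have [N2 h2] := exp_half_lt e0.
pose N := maxn N1 N2; exists (p N); split=> [t t2|].
  apply: le_trans (pP N t t2) _; rewrite lecR; apply: ltW; apply: h2.
  by apply: leq_trans (leq_maxr N1 N2) _; rewrite -[leqLHS]addn0 -addn2 leq_add2l.
rewrite nrmB nrm_le; apply: h1; exact: leq_maxl.
Qed.

Definition fc a f : A := xget 0 [set y | is_fc a f y].

Lemma fcP a f : self_adjoint_lt2 a -> continuous f -> is_fc a f (fc a f).
Proof.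
move=> ha cf; have [y fy] := is_fc_ex ha cf.
exact: (@xgetI _ 0 [set y | is_fc a f y] y).
Qed.

Lemma fc_eq a f y : self_adjoint_lt2 a -> is_fc a f y -> fc a f = y.
Proof.
move=> ha fy; apply: (is_fc_unique ha (f := f) _ fy).
exact: (@xgetI _ 0 [set y | is_fc a f y] y fy).
Qed.

(** If p approximates f, then p(- X) approximates t |-> f (- t). *)
Lemma is_fcN a f y : is_fc a f y -> is_fc (- a) (fun t => f (- t)) y.
Proof.
move=> fy e e0; have [p [pf py]] := fy _ e0.
have comp q : peval (- a) (q \Po (- 'X)) = peval a q.
  elim/poly_ind: q => [|q c IH]; first by rewrite comp_poly0 !peval0.
  rewrite comp_poly_MXaddC !pevalD !pevalMX pevalM IH pevalN pevalX opprK.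
  by rewrite !pevalC.
exists (p \Po (- 'X)); rewrite comp; split=> // t t2.
rewrite horner_comp hornerN hornerX -(rmorphN (real_complex R)).
by apply: pf; rewrite normrN.
Qed.

(** Functions vanishing at 0 are limits of polynomials without constant term,
    that is, multiples of X, and p(a) a b q(b) = 0. *)
Lemma is_fc_orth a b f g y z : a * b = 0 -> f 0 = 0 -> g 0 = 0 ->
  is_fc a f y -> is_fc b g z -> y * z = 0.
Proof.
move=> ab f0 g0 fy gz.
have approx (c : A) h w d : is_fc c h w -> h 0 = 0 -> 0 < d ->
    exists2 q, q.[0] = 0 & nrm (peval c q - w) <= d.
  move=> hw h0 d0; have d2 : 0 < d / 2 by rewrite divr_gt0.
  have [q [qh qw]] := hw _ d2.
  exists (q - q.[0]%:P); first by rewrite hornerD hornerN hornerC subrr.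
  rewrite pevalB pevalC addrAC; apply: le_trans (nrmD _ _) _.
  rewrite [leRHS]splitr; apply: lerD => //.
  rewrite -scaleNr -[leRHS]mulr1.
  apply: le_trans (@nrmZ_le _ _ _ (d / 2) _ _) _.
    by rewrite normrN; have := qh 0; rewrite h0 subr0; apply; rewrite normr0.
  by apply: ler_wpM2l; [exact: ltW|exact: nrm1].
have factor q : q.[0] = 0 -> exists r, q = r * 'X.
  by move=> q0; have /factor_theorem[r] : root q 0 by [apply/eqP]; rewrite subr0; exists r.
apply: (@nrm_small0 _ (1 + nrm y + nrm z)); first by rewrite !addr_ge0 ?nrm_ge0.
move=> e e0; pose d := Num.min 1 e.
have d0 : 0 < d by rewrite lt_min ltr01.
have d1 : d <= 1 by rewrite ge_min lexx.
have [p p0 py] := approx _ _ _ _ fy f0 d0; have [q q0 qz] := approx _ _ _ _ gz g0 d0.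
have := nrm_mul_approx py qz d1.
have -> : peval a p * peval b q = 0.
  have [p' ->] := factor _ p0; have [q' ->] := factor _ q0.
  by rewrite [q' * _]mulrC !pevalM !pevalX mulrA -(mulrA _ a) ab mulr0 mul0r.
rewrite nrmB subr0 => h; apply: le_trans h _.
apply: ler_wpM2r; first by rewrite !addr_ge0 ?nrm_ge0.
by rewrite ge_min lexx orbT.
Qed.

End OneAlgebra.

(** Star homomorphisms commute with polynomials and are contractive. *)
Lemma is_fc_hom (A B : cstarAlgType R) (h : A -> B) a f y : star_hom h ->
  is_fc a f y -> is_fc (h a) f (h y).
Proof.
move=> sh fy e e0; have [p [pf py]] := fy _ e0; exists p; split=> //.
rewrite -(star_hom_peval _ _ sh).
have [hl _ _] := sh.
have -> : h (peval a p) - h y = h (peval a p - y).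
  by have := hl (-1) y (peval a p); rewrite !scaleN1r !(addrC (- _)).
by rewrite nrm_le; apply: le_trans (star_hom_contractive _ sh) _; rewrite -nrm_le.
Qed.

Lemma self_adjoint_lt2_hom (A B : cstarAlgType R) (h : A -> B) a : star_hom h ->
  self_adjoint_lt2 a -> self_adjoint_lt2 (h a).
Proof.
move=> sh [sa a2]; have [_ _ hs] := sh; split; first by rewrite -hs sa.
apply: le_lt_trans a2; rewrite nrm_le.
by apply: le_trans (star_hom_contractive _ sh) _; rewrite -nrm_le.
Qed.

End FunctionalCalculus.

(** * Continuity of complex-valued functions *)

Section ComplexContinuity.
Variable R : realType.

Lemma real_complex_continuous : continuous (fun t : R => t%:C%C : R[i]).
Proof.
move=> t; apply/cvgrPdist_lt => e.
case: e => r i; rewrite ltcE /= => /andP[/eqP -> r0].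
have /cvgrPdist_lt/(_ _ r0) := @cvg_id _ (nbhs t).
apply: filterS => s /= st; rewrite -(rmorphB (real_complex R)).
have -> : `|(t - s)%:C%C : R[i]| = (`|t - s|)%:C%C.
  by rewrite normc_def /= expr0n addr0 sqrtr_sqr.
by rewrite ltcR.
Qed.

Lemma norm_continuous_real (T : topologicalType) (f : T -> R[i]) :
  continuous f -> continuous (fun x => complex.Re `|f x|).
Proof.
move=> cf x; apply/cvgrPdist_lt => e e0.
have eC : 0 < e%:C%C by rewrite (ltcR 0).
have /cvgrPdist_lt/(_ _ eC) := cf x.
apply: filterS => y h; rewrite -ltcR; apply: le_lt_trans h.
apply: le_trans (ler_dist_dist _ _).
have [r _ ->] := norm_realE (f x); have [s _ ->] := norm_realE (f y).
rewrite -(rmorphB (real_complex R)) /=.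
by rewrite normc_def /= expr0n addr0 sqrtr_sqr.
Qed.

Lemma complex_lin_continuous (T : topologicalType) (c : R[i]) (f g : T -> R[i]) :
  continuous f -> continuous g -> continuous (fun x => c * f x + g x).
Proof.
by move=> cf cg x; apply: cvgD; [apply: cvgM; [exact: cvg_cst|exact: cf]|exact: cg].
Qed.

Lemma complex_mul_continuous (T : topologicalType) (f g : T -> R[i]) :
  continuous f -> continuous g -> continuous (fun x => f x * g x).
Proof. by move=> cf cg x; apply: cvgM; [exact: cf|exact: cg]. Qed.

(** These are the real and imaginary parts of a unitary whose real part is
    |f|^2 / M^2; see [unital_ext_norm]. *)
Lemma norm_sqrt_continuous (T : topologicalType) (f : T -> R[i]) (M : R) :
  continuous f ->
  let g x := complex.Re `|f x| ^+ 2 / M ^+ 2 in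
  continuous (fun x => (g x)%:C%C : R[i]) /\
  continuous (fun x => (Num.sqrt (1 - g x ^+ 2))%:C%C : R[i]).
Proof.
move=> cf g; have cn := norm_continuous_real cf.
have cg : continuous g.
  by move=> x; apply: cvgM; [apply: cvgM; exact: cn|exact: cvg_cst].
split=> x; apply: continuous_comp; try exact: real_complex_continuous.
  exact: cg.
apply: (@continuous_comp _ _ _ (fun x => 1 - g x ^+ 2)); last exact: sqrt_continuous.
by apply: cvgB; [exact: cvg_cst|apply: cvgM; exact: cg].
Qed.

End ComplexContinuity.

(** * Functions on the cone *)

Section ConeFunctions.
Variables (R : realType) (k : nat).
Implicit Types (f g : cone_space R k -> R[i]) (r : cone_space R k -> R).

Lemma zero_in_unit : (0 : R) \in `[0, 1]%classic.
Proof. by rewrite inE /= in_itv /= lexx ler01. Qed.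

Definition cone_origin : set_type `[(0 : R), 1]%classic := exist _ 0 zero_in_unit.

Definition cone_apex : cone_space R k := (cone_origin, 0).

Lemma set_val_cone_origin : set_val cone_origin = 0.
Proof. by rewrite set_valE. Qed.

Lemma set_val_origin (s : set_type `[(0 : R), 1]%classic) :
  set_val s = 0 -> s = cone_origin.
Proof. by rewrite set_valE => s0; apply: val_inj. Qed.

(** The unitization of the cone algebra: functions that are constant on
    {0} x Z/k instead of vanishing there. *)
Definition unital_cone_algebra : set (cone_space R k -> R[i]) :=
  [set f | forall l : 'Z_k, continuous (fun s => f (s, l)) /\
     f (cone_origin, l) = f cone_apex].

Local Notation Dplus := unital_cone_algebra.

Lemma ucone_cone f : cone_algebra f <-> Dplus f /\ f cone_apex = 0.
Proof.
split=> [h|[h f0] l].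
  split; last exact: (h 0).2 set_val_cone_origin.
  move=> l; split; first exact: (h l).1.
  by rewrite /cone_apex (h l).2 ?(h 0).2 ?set_val_cone_origin.
by split=> [|s /set_val_origin ->]; [exact: (h l).1|rewrite (h l).2 f0].
Qed.

Lemma ucone_cst c : Dplus (fun=> c).
Proof. by move=> l; split=> // s; exact: cst_continuous. Qed.

Lemma ucone_lin c f g : Dplus f -> Dplus g -> Dplus (fun p => c * f p + g p).
Proof.
move=> hf hg l; split; last by rewrite (hf l).2 (hg l).2.
by apply: complex_lin_continuous; [exact: (hf l).1|exact: (hg l).1].
Qed.

Lemma uconeM f g : Dplus f -> Dplus g -> Dplus (fun p => f p * g p).
Proof.
move=> hf hg l; split; last by rewrite (hf l).2 (hg l).2.
by apply: complex_mul_continuous; [exact: (hf l).1|exact: (hg l).1].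
Qed.

Lemma uconeJ f : Dplus f -> Dplus (fun p => (f p)^*).
Proof.
by move=> hf l; split; [exact: (conjC_continuous (hf l).1)|rewrite (hf l).2].
Qed.

Lemma ucone_centered f : Dplus f -> cone_algebra (fun p => f p - f cone_apex).
Proof.
move=> hf; apply/ucone_cone; split; last by rewrite subrr.
have := ucone_lin 1 hf (ucone_cst (- f cone_apex)).
by congr (Dplus _); apply/funext => p; rewrite mul1r.
Qed.

(** The self-adjoint elements of the cone, kept as real-valued functions so
    that functions of a real variable can be composed with them. *)
Definition real_cone : set (cone_space R k -> R) :=
  [set r | forall l : 'Z_k, continuous (fun s => r (s, l)) /\
     r (cone_origin, l) = 0].

Lemma real_cone_comp r (h : R -> R[i]) : real_cone r -> continuous h ->
  Dplus (fun p => h (r p)).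
Proof.
move=> hr ch l; split; last by rewrite (hr l).2 (hr 0).2.
move=> s; apply: (@continuous_comp _ _ _ (fun s => r (s, l)) h).
  exact: (hr l).1.
exact: ch.
Qed.

Lemma real_cone_cone r : real_cone r -> cone_algebra (fun p => (r p)%:C%C).
Proof.
move=> hr; apply/ucone_cone; split; last by rewrite (hr 0).2.
exact: (real_cone_comp hr (@real_complex_continuous R)).
Qed.

Lemma ucone_norm_sqrt f (M : R) : Dplus f -> 0 < M ->
  let g p := complex.Re `|f p| ^+ 2 / M ^+ 2 in
  Dplus (fun p => (g p)%:C%C) /\
  Dplus (fun p => (Num.sqrt (1 - g p ^+ 2))%:C%C).
Proof.
move=> hf M0 g.
have gl l : g (cone_origin, l) = g cone_apex by rewrite /g (hf l).2.
by split=> l; split; rewrite ?gl//; have [] := norm_sqrt_continuous M (hf l).1.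
Qed.

End ConeFunctions.

(** * The unital extension of a homomorphism from the cone *)

Section UnitalExtension.
Variables (R : realType) (k : nat) (B : cstarAlgType R).
Variable rho : (cone_space R k -> R[i]) -> B.
Hypothesis rho_hom : fun_star_hom (@cone_algebra R k) rho.
Implicit Types (f g : cone_space R k -> R[i]) (r : cone_space R k -> R).
Local Notation Dplus := (@unital_cone_algebra R k).
Local Notation apex := (@cone_apex R k).

Definition unital_ext f : B := f apex *: (1 : B) + rho (fun p => f p - f apex).

Let rho_lin c f g : cone_algebra f -> cone_algebra g ->
  rho (fun p => c * f p + g p) = c *: rho f + rho g.
Proof. by case: rho_hom => h _ _; exact: h. Qed.

Let cone0 : @cone_algebra R k (fun=> 0).
Proof. by apply/ucone_cone; split=> //; exact: ucone_cst. Qed.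

Let rho0 : rho (fun=> 0) = 0.
Proof.
have := rho_lin 1 cone0 cone0; rewrite scale1r.
have -> : (fun=> 1 * 0 + 0) = (fun=> 0) :> (cone_space R k -> R[i]).
  by apply/funext => p; rewrite mulr0 addr0.
by move/(congr1 (fun z => z - rho (fun=> 0))); rewrite subrr addrK => <-.
Qed.

Lemma unital_ext_cone f : cone_algebra f -> unital_ext f = rho f.
Proof.
move=> /ucone_cone[_ f0]; rewrite /unital_ext f0 scale0r add0r.
by congr rho; apply/funext => p; rewrite subr0.
Qed.

Lemma unital_ext_cst c : unital_ext (fun=> c) = c *: (1 : B).
Proof.
rewrite /unital_ext (_ : (fun p => _ - _) = fun=> 0) ?rho0 ?addr0//.
by apply/funext => p; rewrite subrr.
Qed.

Lemma unital_ext_lin c f g : Dplus f -> Dplus g ->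
  unital_ext (fun p => c * f p + g p) = c *: unital_ext f + unital_ext g.
Proof.
move=> hf hg; rewrite /unital_ext scalerDr scalerDl -scalerA.
rewrite addrACA -rho_lin; last 2 first.
- exact: ucone_centered.
- exact: ucone_centered.
by congr (_ + rho _); apply/funext => p; ring.
Qed.

Lemma unital_extM f g : Dplus f -> Dplus g ->
  unital_ext (fun p => f p * g p) = unital_ext f * unital_ext g.
Proof.
move=> hf hg; rewrite /unital_ext.
have cf := ucone_centered hf; have cg := ucone_centered hg.
have cfg : cone_algebra (fun p => (f p - f apex) * (g p - g apex)).
  apply/ucone_cone; split; last by rewrite subrr mul0r.
  by apply: uconeM; [case/ucone_cone: cf|case/ucone_cone: cg].
have [_ rhoM _] := rho_hom.
have clin c (u v : cone_space R k -> R[i]) : cone_algebra u -> cone_algebra v ->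
    cone_algebra (fun p => c * u p + v p).
  move=> /ucone_cone[hu u0] /ucone_cone[hv v0]; apply/ucone_cone.
  by split; [exact: ucone_lin|rewrite u0 v0 mulr0 addr0].
have -> : (fun p => f p * g p - f apex * g apex) =
    (fun p => f apex * (g p - g apex) + (g apex * (f p - f apex) +
      (f p - f apex) * (g p - g apex))).
  by apply/funext => p; ring.
rewrite rho_lin//; last exact: clin.
rewrite rho_lin// rhoM// mulrDl !mulrDr -!cscalerAl -!cscalerAr !mul1r !mulr1.
by rewrite scalerA -!addrA.
Qed.

Lemma unital_extJ f : Dplus f ->
  unital_ext (fun p => (f p)^*) = star (unital_ext f).
Proof.
move=> hf; have [_ _ rhoJ] := rho_hom.
rewrite /unital_ext starD starZ star1 -rhoJ; last exact: ucone_centered.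
by congr (_ + rho _); apply/funext => p; rewrite rmorphB.
Qed.

(** Contractivity.  By the C*-identity it suffices to bound the image of
    g = |f|^2 / K^2 with K slightly above M.  As 0 <= g <= 1, g is the real part
    of the function u = g + i sqrt (1 - g^2), which has modulus 1, so that the
    image of g is the mean of a unitary and its adjoint. *)
Lemma unital_ext_norm f (M : R) : Dplus f -> (forall p, `|f p| <= M%:C%C) ->
  nrm (unital_ext f) <= M.
Proof.
move=> hf fM.
have M0 : 0 <= M by rewrite -ler0c; exact: le_trans (fM apex).
apply/ler_addgt0Pr => e e0; set K := M + e.
have K0 : 0 < K by rewrite ltr_wpDl.
have := ucone_norm_sqrt hf K0; set g := fun p => _ => -[hg hs].
pose h p := Num.sqrt (1 - g p ^+ 2).
have g01 p : 0 <= g p <= 1.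
  have [r r0 rE] := norm_realE (f p); rewrite /g rE /=.
  rewrite divr_ge0 ?exprn_ge0 ?(ltW K0)//= ler_pdivrMr ?exprn_gt0// mul1r.
  rewrite ler_pXn2r ?nnegrE ?(ltW K0)//.
  by have := fM p; rewrite rE lecR /K => /le_trans; apply; rewrite lerDl ltW.
have hE p : h p ^+ 2 = 1 - g p ^+ 2.
  rewrite /h sqr_sqrtr// subr_ge0; have /andP[a b] := g01 p.
  by rewrite expr_le1.
have rJ (t : R) : (t%:C%C)^* = t%:C%C by apply/eqP; rewrite eq_complex /= oppr0 !eqxx.
(* The unitary function u = g + i sqrt (1 - g^2). *)
pose u p := 'i * (h p)%:C%C + (g p)%:C%C.
have hu : Dplus u by exact: ucone_lin.
have uu p : (u p)^* * u p = 1.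
  rewrite /u rmorphD rmorphM /= conjCi !rJ mulNr [_ + (g p)%:C%C]addrC.
  rewrite [_ + (g p)%:C%C in X in _ * X]addrC -subr_sqr exprMn sqrCi.
  rewrite mulN1r opprK -!(rmorphXn (real_complex R)) -(rmorphD (real_complex R)) hE.
  by rewrite addrC subrK.
have nu : nrm (unital_ext u) <= 1.
  rewrite -(@ler_pXn2r _ 2) ?nnegrE ?nrm_ge0// -nrm_star_mul expr1n.
  rewrite -unital_extJ// -unital_extM//; last exact: uconeJ.
  have -> : (fun p => (u p)^* * u p) = fun=> 1 by apply/funext => p; exact: uu.
  by rewrite unital_ext_cst scale1r nrm1.
have gE : unital_ext (fun p => (g p)%:C%C) = 2^-1 *: (star (unital_ext u) + unital_ext u).
  rewrite -unital_extJ// -[unital_ext (fun p => _^*)]scale1r.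
  rewrite -unital_ext_lin//; last exact: uconeJ.
  have -> : (fun p => 1 * (u p)^* + u p) = (fun p => 2 * (g p)%:C%C + 0).
    by apply/funext => p; rewrite /u rmorphD rmorphM /= conjCi !rJ; ring.
  rewrite unital_ext_lin//; last exact: ucone_cst.
  by rewrite unital_ext_cst scale0r addr0 scalerA mulVf ?scale1r// pnatr_eq0.
have ng : nrm (unital_ext (fun p => (g p)%:C%C)) <= 1.
  rewrite gE; apply: le_trans (@nrmZ_le _ _ _ 2^-1 _ _) _.
    by rewrite ger0_norm ?invr_ge0 ?ler0n// fmorphV rmorph_nat.
  rewrite mulrC ler_pdivrMr// mul1r; apply: le_trans (nrmD _ _) _.
  by rewrite nrm_star; apply: le_trans (lerD nu nu) _.
rewrite -(@ler_pXn2r _ 2) ?nnegrE ?nrm_ge0 ?(ltW K0)// -nrm_star_mul.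
rewrite -unital_extJ// -unital_extM//; last exact: uconeJ.
have -> : (fun p => (f p)^* * f p) = (fun p => (K ^+ 2)%:C%C * (g p)%:C%C + 0).
  apply/funext => p; rewrite addr0 -(rmorphM (real_complex R)) /g [K ^+ 2 * _]mulrC divfK.
    have [r r0 rE] := norm_realE (f p).
    by rewrite mulrC -normCK rE /= (rmorphXn (real_complex R)).
  by rewrite expf_neq0// gt_eqF.
rewrite unital_ext_lin//; last exact: ucone_cst.
rewrite unital_ext_cst scale0r addr0.
apply: le_trans (@nrmZ_le _ _ _ (K ^+ 2) _ _) _.
  by rewrite ger0_norm// ler0c exprn_ge0// ltW.
by rewrite -[leRHS]mulr1; apply: ler_wpM2l => //; rewrite exprn_ge0// ltW.
Qed.

Lemma unital_ext_poly f (p : {poly R[i]}) : Dplus f ->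
  Dplus (fun x => p.[f x]) /\ unital_ext (fun x => p.[f x]) = peval (unital_ext f) p.
Proof.
move=> hf; elim/poly_ind: p => [|p c [IH1 IH2]].
  rewrite (_ : (fun x => _) = fun=> 0); last by apply/funext => x; rewrite horner0.
  by rewrite unital_ext_cst scale0r peval0; split=> //; exact: ucone_cst.
rewrite (_ : (fun x => _) = fun x => 1 * (p.[f x] * f x) + c); last first.
  by apply/funext => x; rewrite hornerMXaddC mul1r.
have hpf := uconeM IH1 hf.
split; first exact: ucone_lin hpf (@ucone_cst _ _ c).
rewrite unital_ext_lin//; last exact: ucone_cst.
by rewrite unital_extM// IH2 scale1r unital_ext_cst pevalD pevalMX pevalC.
Qed.

(** Naturality of the functional calculus under the homomorphism; the unital
    extension is what makes sense of functions h with h(0) <> 0. *)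
Lemma unital_ext_fc r (h : R -> R[i]) : real_cone r -> (forall p, `|r p| <= 2) ->
  continuous h ->
  is_fc (rho (fun p => (r p)%:C%C)) h (unital_ext (fun p => h (r p))).
Proof.
move=> hr r2 ch e e0; have [q qh] := weierstrass ch e0; exists q; split=> //.
have hC := real_cone_cone hr; have /ucone_cone[hD _] := hC.
rewrite -unital_ext_cone//; have [D1 <-] := unital_ext_poly q hD.
have D2 := real_cone_comp hr ch.
have := unital_ext_lin (-1) D2 D1; rewrite scaleN1r addrC => <-.
apply: unital_ext_norm; first exact: ucone_lin.
by move=> p; rewrite mulN1r addrC; apply: qh.
Qed.

End UnitalExtension.

(** * The signs of the dyadic filtration of the cyclic group *)

Section DyadicSigns.
Variables (m : nat) (m0 : (0 < m)%N).
Local Notation G := 'Z_(2 ^ m)%N.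
Implicit Types (d : nat) (g l : G).

Lemma val_dyadicD l g : (l + g : G) = ((l + g) %% 2 ^ m)%N :> nat.
Proof.
rewrite /=; congr (_ %% _)%N.
by apply: Zp_cast; rewrite -[1%N]/(2 ^ 0)%N ltn_exp2l.
Qed.

(** Membership in the subgroup of multiples of 2^d.  For d <= m it depends only
    on the class modulo 2^m. *)
Definition dyadic d l := (2 ^ d %| l)%N.
Definition dyadic_odd d l := odd (l %/ 2 ^ d).

Lemma dyadicD d l g : (d <= m)%N -> dyadic d g -> dyadic d (l + g) = dyadic d l.
Proof.
move=> dm hg; rewrite /dyadic val_dyadicD.
have h : (2 ^ d %| 2 ^ m)%N by rewrite dvdn_exp2l.
by rewrite /dvdn modn_dvdm// -/(dvdn _ _) dvdn_addl.
Qed.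

Lemma dyadic0 d : dyadic d (0 : G).
Proof. exact: dvdn0. Qed.

Lemma dyadicN d g : (d <= m)%N -> dyadic d g -> dyadic d (- g).
Proof. by move=> dm hg; rewrite -(dyadicD (- g) dm hg) addNr dyadic0. Qed.

Lemma dyadic_oddD d l g : (d < m)%N -> dyadic d l -> dyadic d g ->
  dyadic_odd d (l + g) = dyadic_odd d l (+) dyadic_odd d g.
Proof.
move=> dm hl hg; rewrite /dyadic_odd val_dyadicD.
have e : (2 ^ m = 2 ^ (m - d.+1) * 2 * 2 ^ d)%N.
  by rewrite -expnSr -expnD; congr expn; lia.
have d2 : (0 < 2 ^ d)%N by rewrite expn_gt0.
case/dvdnP: hl => a ->; case/dvdnP: hg => b ->.
rewrite e -mulnDl -muln_modl !mulnK// -oddD.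
by rewrite [in RHS](divn_eq (a + b) (2 ^ (m - d.+1) * 2)) oddD !oddM !andbF.
Qed.

Lemma dyadicS d l : dyadic d.+1 l = dyadic d l && ~~ dyadic_odd d l.
Proof.
rewrite /dyadic /dyadic_odd; have d2 : (0 < 2 ^ d)%N by rewrite expn_gt0.
apply/idP/andP => [/dvdnP[a ->]|[/dvdnP[a ->]]].
  by rewrite expnS mulnA dvdn_mull// mulnK// oddM andbF.
rewrite mulnK// expnS => oa; rewrite dvdn_pmul2r// dvdn2.
exact: oa.
Qed.

Lemma dyadic_top l : dyadic m l -> l = 0.
Proof.
rewrite /dyadic => h; apply: val_inj => /=.
have lm : (l < 2 ^ m)%N.
  have := ltn_ord l; rewrite [X in (_ < X)%N -> _]Zp_cast//.
  by rewrite -[1%N]/(2 ^ 0)%N ltn_exp2l.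
by have [//|l0] := posnP (nat_of_ord l); rewrite gtnNdvd in h.
Qed.

Variable R : realType.

(** For d < m, the character of order 2 of the subgroup [dyadic d], with kernel
    [dyadic d.+1], extended by 0 to the whole group. *)
Definition dyadic_sign d l : R :=
  if dyadic d l then (-1) ^+ dyadic_odd d l else 0.

Lemma dyadic_signD d l g : (d < m)%N -> dyadic d g ->
  dyadic_sign d (l + g) = dyadic_sign d l * dyadic_sign d g.
Proof.
move=> dm hg; rewrite /dyadic_sign hg dyadicD ?(ltnW dm)//.
case: ifP => hl; last by rewrite mul0r.
by rewrite dyadic_oddD// signr_addb.
Qed.

Lemma dyadic_sign0 d : dyadic_sign d 0 = 1.
Proof. by rewrite /dyadic_sign dyadic0 /dyadic_odd div0n. Qed.

Lemma dyadic_sign_sqr d l : dyadic d l -> dyadic_sign d l * dyadic_sign d l = 1.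
Proof. by move=> hl; rewrite /dyadic_sign hl -expr2 sqrr_sign. Qed.

Lemma dyadic_signN d g : (d < m)%N -> dyadic d g -> dyadic_sign d (- g) = dyadic_sign d g.
Proof.
move=> dm hg; rewrite -[LHS]mulr1 -(dyadic_sign_sqr hg) mulrA -dyadic_signD//.
by rewrite addNr dyadic_sign0 mul1r.
Qed.

Lemma norm_dyadic_sign d l : `|dyadic_sign d l| <= 1.
Proof.
by rewrite /dyadic_sign; case: ifP => _; rewrite ?normr0// normr_sign.
Qed.

End DyadicSigns.

(** * Cut-off and root functions *)

Section AuxiliaryFunctions.
Variable R : realType.

Definition clamp (t : R) : R := Num.max 0 (Num.min t 1).

Lemma clamp_ge0 t : 0 <= clamp t.
Proof. by rewrite /clamp le_max lexx. Qed.

Lemma clamp_le1 t : clamp t <= 1.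
Proof. by rewrite /clamp ge_max ler01 ge_min lexx orbT. Qed.

Lemma clamp_id t : 0 <= t <= 1 -> clamp t = t.
Proof. by move=> /andP[t0 t1]; rewrite /clamp min_l// max_r. Qed.

Lemma clamp_neg t : t <= 0 -> clamp t = 0.
Proof. by move=> t0; rewrite /clamp max_l// ge_min t0. Qed.

Lemma clamp_continuous : continuous clamp.
Proof.
move=> t.
apply: (@continuous_max _ R (fun=> 0) (fun t => Num.min t 1)).
  exact: cst_continuous.
apply: (@continuous_min _ R id (fun=> 1)); first exact: cvg_id.
exact: cst_continuous.
Qed.

(** A weight w with w(t) sqrt(t) w(t) = t on [0, 1] and w(t) = 0 for t <= 0:
    compressing a lift of the square root of the coordinate by w of an element
    that lifts the coordinate gives a lift of the coordinate again. *)
Definition root4 (t : R) : R := Num.sqrt (Num.sqrt (clamp t)).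

Lemma root4_continuous : continuous root4.
Proof.
move=> t; apply: (@continuous_comp _ _ _ (fun t => Num.sqrt (clamp t)) (@Num.sqrt R)).
  by apply: (@continuous_comp _ _ _ clamp (@Num.sqrt R));
    [exact: clamp_continuous|exact: sqrt_continuous].
exact: sqrt_continuous.
Qed.

Lemma root4_ge0 t : 0 <= root4 t.
Proof. exact: sqrtr_ge0. Qed.

Lemma root4_le1 t : root4 t <= 1.
Proof. by rewrite /root4 -sqrtr1 ler_wsqrtr// -sqrtr1 ler_wsqrtr// clamp_le1. Qed.

Lemma root4_neg t : t <= 0 -> root4 t = 0.
Proof. by move=> t0; rewrite /root4 clamp_neg// !sqrtr0. Qed.

Lemma root4_sqr t : 0 <= t <= 1 -> root4 t * root4 t * Num.sqrt t = t.
Proof.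
move=> h; rewrite /root4 clamp_id//; have /andP[t0 _] := h.
by rewrite -expr2 sqr_sqrtr ?sqrtr_ge0// -expr2 sqr_sqrtr.
Qed.

Lemma clamp_in t : clamp t \in `[0, 1]%classic.
Proof. by rewrite inE /= in_itv /= clamp_ge0 clamp_le1. Qed.

Definition unit_clamp (t : R) : set_type `[(0 : R), 1]%classic :=
  exist _ (clamp t) (clamp_in t).

Lemma unit_clamp_continuous : continuous unit_clamp.
Proof.
apply: continuous_comp_initial => t; rewrite /= set_valE.
exact: clamp_continuous.
Qed.

Lemma set_val_unit_clamp t : set_val (unit_clamp t) = clamp t.
Proof. by rewrite set_valE. Qed.

Lemma set_val_unit (s : set_type `[(0 : R), 1]%classic) : 0 <= set_val s <= 1.
Proof.
have := set_valP s; rewrite /= in_itv //=.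
Qed.

Lemma unit_clamp_neg t : t <= 0 -> unit_clamp t = cone_origin R.
Proof. by move=> t0; apply: set_val_origin; rewrite set_val_unit_clamp clamp_neg. Qed.

Lemma continuous_comp_unit (Y : topologicalType) (h : R -> Y) : continuous h ->
  continuous (fun s : set_type `[(0 : R), 1]%classic => h (set_val s)).
Proof.
move=> ch s; apply: (@continuous_comp _ _ _ (@set_val R `[(0 : R), 1]%classic) h).
  exact: initial_continuous.
exact: ch.
Qed.

End AuxiliaryFunctions.

(** * Elementary properties of star homomorphisms *)

Section StarHom.
Variables (R : realType) (A B : cstarAlgType R) (h : A -> B).
Hypothesis sh : star_hom h.

Lemma star_homD a b : h (a + b) = h a + h b.
Proof. by case: sh => hl _ _; have := hl 1 a b; rewrite !scale1r. Qed.

Lemma star_hom0 : h 0 = 0.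
Proof. by have := star_homD 0 0; rewrite addr0 => /eqP; rewrite -subr_eq subrr => /eqP. Qed.

Lemma star_homZ c a : h (c *: a) = c *: h a.
Proof. by case: sh => hl _ _; have := hl c a 0; rewrite star_hom0 !addr0. Qed.

Lemma star_homM a b : h (a * b) = h a * h b.
Proof. by case: sh => _ [_ hM] _. Qed.

Lemma star_hom1 : h 1 = 1.
Proof. by case: sh => _ [h1 _] _. Qed.

Lemma star_homB a b : h (a - b) = h a - h b.
Proof. by rewrite -scaleN1r star_homD star_homZ scaleN1r. Qed.

Lemma star_homJ a : h (star a) = star (h a).
Proof. by case: sh => _ _. Qed.

Lemma star_hom_sum (I : finType) (F : I -> A) : h (\sum_i F i) = \sum_i h (F i).
Proof. exact: (big_morph h star_homD star_hom0). Qed.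

Lemma star_hom_nrm a : nrm (h a) <= nrm a.
Proof. by rewrite -lecR -!nrmE star_hom_contractive. Qed.

End StarHom.

(** * Equivariant lifting of the cone *)

Section EquivariantLifting.
Variables (R : realType) (m : nat) (m0 : (0 < m)%N).
Local Notation k := (2 ^ m)%N.
Local Notation G := 'Z_k.
Variables (A : cstarAlgType R) (alpha : cstar_action G A).

Lemma realcJ (t : R) : (t%:C%C)^* = t%:C%C.
Proof. by apply/eqP; rewrite eq_complex /= oppr0 !eqxx. Qed.

(** The subgroup [dyadic d] acts on D through its character of order 2. *)
Definition graded d (D : A) := forall l, dyadic d l ->
  alpha l D = (dyadic_sign R d l)%:C%C *: D.

(** What survives in the whole algebra of the function
    (s, l) |-> dyadic_sign d l * s on the cone: its translates by [dyadic d] are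
    the function itself up to sign, and its other translates have disjoint
    support. *)
Definition dyadic_element d (D : A) := [/\ self_adjoint_lt2 D, graded d D
  & forall l, ~~ dyadic d l -> D * alpha l D = 0].

Lemma fc_act g D (u : R -> R[i]) y : is_fc D u y -> is_fc (alpha g D) u (alpha g y).
Proof. exact: is_fc_hom (act_hom alpha g). Qed.

(** Functions of the positive part of D are orthogonal to their translates
    outside [dyadic d.+1].  For a translation outside [dyadic d] this is the
    orthogonality of D and its translate; for an odd element of [dyadic d] the
    translate of D is - D, and the positive part is orthogonal to the negative
    one. *)
Lemma positive_part_orth d D (u v : R -> R[i]) y z l : dyadic_element d D ->
  continuous u -> continuous v ->
  (forall t, t <= 0 -> u t = 0) -> (forall t, t <= 0 -> v t = 0) ->
  is_fc D u y -> is_fc D v z -> ~~ dyadic d.+1 l -> y * alpha l z = 0.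
Proof.
move=> [hD gD oD] cu cv u0 v0 uy vz; rewrite dyadicS negb_and negbK.
have [hl /= odl|hl _] := boolP (dyadic d l); last first.
  exact: is_fc_orth (oD _ hl) (u0 0 (lexx _)) (v0 0 (lexx _)) uy (fc_act l vz).
have DN : - alpha l D = D.
  rewrite gD// /dyadic_sign hl odl expr1 (rmorphN1 (real_complex R)).
  by rewrite scaleN1r opprK.
have := is_fcN (fc_act l vz); rewrite DN => vz'.
have cv' : continuous (fun t => v (- t)).
  move=> t; apply: (@continuous_comp _ _ _ (@GRing.opp R) v); last exact: cv.
  exact: opp_continuous.
apply: nrm_eq0; apply: (is_fc_norm hD (is_fcM cu cv' uy vz')) => t _.
have [t0|t0] := leP t 0; first by rewrite u0// mul0r normr0.
by rewrite [v _]v0 ?mulr0 ?normr0// oppr_le0 ltW.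
Qed.

Variables (B : cstarAlgType R) (beta : cstar_action G B) (pi : A -> B).
Hypothesis pi_hom : star_hom pi.
Hypothesis pi_act : forall g a, pi (alpha g a) = beta g (pi a).
Hypothesis pi_lift : forall (u : B) (e : R), 0 < e ->
  exists2 a, pi a = u & nrm a < nrm u + e.
Variable rho : (cone_space R k -> R[i]) -> B.
Hypothesis rho_equiv : equivariant_cone_hom beta rho.
Let rho_hom := proj1 rho_equiv.

(** Any lift of norm < 2 is made self-adjoint by averaging with its adjoint, and
    then graded by averaging its translates against the character.  Neither
    changes the image, which has these properties already, nor increases the
    norm.  The norm stays below 2 without any further correction because the
    image has norm at most 1 and the quotient norm is an infimum over lifts. *)
Lemma graded_lift d (x : cone_space R k -> R) : (d < m)%N ->
  real_cone x -> (forall p, `|x p| <= 1) ->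
  (forall s l g, dyadic d g -> x (s, l - g) = dyadic_sign R d g * x (s, l)) ->
  exists X, [/\ self_adjoint_lt2 X, pi X = rho (fun p => (x p)%:C%C) & graded d X].
Proof.
move=> dm hx x1 gx; set u := rho _.
have xC : cone_algebra (fun p => (x p)%:C%C) by exact: real_cone_cone.
have [xD _] := (iffLR (ucone_cone _)) xC.
have uE : u = unital_ext rho (fun p => (x p)%:C%C) by rewrite unital_ext_cone.
have u1 : nrm u <= 1.
  rewrite uE; apply: unital_ext_norm => // p.
  by rewrite normc_def /= expr0n addr0 sqrtr_sqr lecR.
have su : star u = u.
  rewrite uE -unital_extJ//; congr unital_ext; apply/funext => p; exact: realcJ.
(* The image u is already graded, so averaging does not move it. *)
have bu g : dyadic d g -> beta g u = (dyadic_sign R d g)%:C%C *: u.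
  move=> hg; rewrite /u -(proj2 rho_equiv)//.
  have -> : cone_translate g (fun p => (x p)%:C%C) =
      (fun p => (dyadic_sign R d g)%:C%C * (x p)%:C%C + 0).
    apply/funext => -[s l]; rewrite /cone_translate /= gx//.
    by rewrite addr0 (rmorphM (real_complex R)).
  have zD : unital_cone_algebra (fun p => (dyadic_sign R d g)%:C%C * (x p)%:C%C + 0).
    by apply: ucone_lin => //; exact: ucone_cst.
  have zC : cone_algebra (fun p => (dyadic_sign R d g)%:C%C * (x p)%:C%C + 0).
    by apply/ucone_cone; split=> //; rewrite (hx 0).2 mulr0 addr0.
  rewrite -(unital_ext_cone rho zC) -(unital_ext_cone rho xC).
  by rewrite unital_ext_lin// ?unital_ext_cst ?scale0r ?addr0//; exact: ucone_cst.
have [X0 pX0 nX0] := pi_lift u ltr01.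
have nX02 : nrm X0 < 2 by apply: lt_le_trans nX0 _; rewrite -[leRHS](natrD _ 1 1) lerD2r.
pose X1 := 2^-1 *: (X0 + star X0).
have half_nrm (y : A) : nrm (2^-1 *: y) <= 2^-1 * nrm y.
  apply: nrmZ_le.
  by rewrite ger0_norm ?invr_ge0 ?ler0n// fmorphV rmorph_nat.
have sX1 : star X1 = X1.
  by rewrite /X1 starZ starD starK fmorphV rmorph_nat addrC.
have nX1 : nrm X1 < 2.
  apply: le_lt_trans (half_nrm _) _; have := nrmD X0 (star X0).
  by rewrite nrm_star; lra.
have pX1 : pi X1 = u.
  rewrite /X1 (star_homZ pi_hom) (star_homD pi_hom) (star_homJ pi_hom) pX0 su.
  have -> : u + u = (2 : R[i]) *: u by rewrite scaler_nat mulr2n.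
  by rewrite scalerA mulVf ?scale1r// pnatr_eq0.
pose H := [set g : G | dyadic d g]%SET.
pose n := #|H|.
have n0 : (0 < n)%N by apply/card_gt0P; exists 0; rewrite inE dyadic0.
have nR : 0 < n%:R :> R by rewrite ltr0n.
pose e (g : G) : R[i] := (dyadic_sign R d g)%:C%C.
pose X := (n%:R)^-1 *: (\sum_g e g *: alpha g X1).
have eJ g : (e g)^* = e g by exact: realcJ.
have e0 g : g \notin H -> e g = 0.
  by rewrite inE /e /dyadic_sign => /negbTE ->.
have sumH (C : cstarAlgType R) (F : G -> C) : \sum_g e g *: F g = \sum_(g in H) e g *: F g.
  rewrite (bigID (mem H)) /= [X in _ + X]big1 ?addr0// => g gH.
  by rewrite e0// scale0r.
exists X; split.
- split.
    rewrite starZ fmorphV rmorph_nat star_sum; congr (_ *: _).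
    apply: eq_bigr => g _; rewrite starZ eJ.
    by rewrite -(star_homJ (act_hom alpha g)) sX1.
  apply: le_lt_trans nX1.
  apply: le_trans (@nrmZ_le _ _ _ (n%:R)^-1 _ _) _.
    by rewrite ger0_norm ?invr_ge0 ?ler0n// (fmorphV (real_complex R))
      (rmorph_nat (real_complex R)).
  rewrite mulrC ler_pdivrMr// mulrC sumH.
  apply: (@le_trans _ _ (\sum_(g in H) nrm X1)); last first.
    by rewrite sumr_const mulr_natl.
  apply: (big_ind2 (fun x y => nrm x <= y)); first by rewrite nrm0.
    by move=> y1 t1 y2 t2 h1 h2; apply: le_trans (nrmD _ _) _; exact: lerD.
  move=> g _; apply: le_trans (@nrmZ_le _ _ _ 1 _ _) _.
    by rewrite /e normc_def /= expr0n addr0 sqrtr_sqr lecR norm_dyadic_sign.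
  by rewrite mul1r; exact: star_hom_nrm (act_hom alpha g) _.
- rewrite /X (star_homZ pi_hom) (star_hom_sum pi_hom).
  under eq_bigr => g _ do rewrite (star_homZ pi_hom) pi_act pX1.
  rewrite sumH; under eq_bigr => g.
    rewrite inE => hg; rewrite bu// scalerA -(rmorphM (real_complex R)).
    rewrite dyadic_sign_sqr// scale1r; over.
  rewrite sumr_const -/n (_ : u *+ n = (n%:R : R[i]) *: u); last by rewrite scaler_nat.
  rewrite scalerA mulVf ?scale1r//.
  by rewrite pnatr_eq0 -lt0n.
- move=> g hg; rewrite /X (star_homZ (act_hom alpha g)) (star_hom_sum (act_hom alpha g)).
  rewrite scalerA mulrC -scalerA; congr (_ *: _).
  rewrite scaler_sumr (reindex_inj (addrI (- g))) /=.
  apply: eq_bigr => l _.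
  rewrite (star_homZ (act_hom alpha g)) -actD addrA subrr add0r scalerA.
  congr (_ *: _); rewrite /e -(rmorphM (real_complex R)) addrC.
  rewrite (dyadic_signD m0) ?dyadicN// ?(ltnW dm)// dyadic_signN//.
  by rewrite mulrC.
Qed.

Definition dyadic_coord d (p : cone_space R k) : R :=
  dyadic_sign R d p.2 * set_val p.1.

Lemma signed_real_cone d (h : R -> R) : continuous h -> h 0 = 0 ->
  real_cone (fun p : cone_space R k => dyadic_sign R d p.2 * h (set_val p.1)).
Proof.
move=> ch h0 l; split; last by rewrite /= set_val_cone_origin h0 mulr0.
apply: (@continuous_comp_unit _ _ (fun t => dyadic_sign R d l * h t)) => t.
by apply: cvgM; [exact: cvg_cst|exact: ch].
Qed.

Lemma signed_shift d (h : R -> R) (s : set_type `[(0 : R), 1]%classic) (l g : G) :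
  (d < m)%N -> dyadic d g ->
  dyadic_sign R d (l - g) * h (set_val s) =
  dyadic_sign R d g * (dyadic_sign R d l * h (set_val s)).
Proof.
move=> dm hg; rewrite (dyadic_signD m0) ?dyadicN ?(ltnW dm)// dyadic_signN//.
by rewrite mulrCA mulrA.
Qed.

Lemma signed_le1 d (h : R -> R) (p : cone_space R k) :
  (forall t, 0 <= t <= 1 -> 0 <= h t <= 1) ->
  `|dyadic_sign R d p.2 * h (set_val p.1)| <= 1.
Proof.
move=> h01; rewrite normrM -[leRHS]mulr1.
have /andP[a b] := h01 _ (set_val_unit p.1).
by apply: ler_pM => //; [exact: norm_dyadic_sign|rewrite ger0_norm].
Qed.

(** Both sides are values of the functional calculus at the image of D. *)
Lemma fc_rho (D : A) (r : cone_space R k -> R) (u : R -> R[i]) y :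
  self_adjoint_lt2 D -> real_cone r -> (forall p, `|r p| <= 1) ->
  pi D = rho (fun p => (r p)%:C%C) -> continuous u -> is_fc D u y ->
  pi y = unital_ext rho (fun p => u (r p)).
Proof.
move=> hD hr r1 pD cu uy.
apply: (is_fc_unique (self_adjoint_lt2_hom pi_hom hD) (is_fc_hom pi_hom uy)).
rewrite pD; apply: unital_ext_fc => // p; apply: le_trans (r1 p) _.
by rewrite -[leLHS]/(1%:R) ler_nat.
Qed.

Lemma dyadic_coord_le1 d p : `|dyadic_coord d p| <= 1.
Proof. exact: (@signed_le1 d id p). Qed.

Lemma dyadic_coord_cone d : real_cone (dyadic_coord d).
Proof. by apply: (@signed_real_cone d id) => // t; exact: cvg_id. Qed.

(** Induction on d.  Let D be the lift for d, E = w(D) with w = [root4], and X a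
    graded lift of the function dyadic_sign d.+1 l * sqrt s.  Then E X E is the
    lift for d.+1: E is fixed by [dyadic d.+1] and orthogonal to its other
    translates, so compressing by E brings the orthogonality that X alone does
    not have, and w(s)^2 sqrt s = s keeps the image exact. *)
Lemma dyadic_lift d : (d < m)%N ->
  exists D, dyadic_element d D /\ pi D = rho (fun p => (dyadic_coord d p)%:C%C).
Proof.
elim: d => [|d IH] dm.
  have [D [hD pD gD]] := graded_lift dm (dyadic_coord_cone 0) (dyadic_coord_le1 0)
    (fun s l g hg => signed_shift id s l dm hg).
  by exists D; split=> //; split=> // l; rewrite /dyadic dvd1n.
have [D [[hD gD oD] pD]] := IH (ltnW dm).
have sqrt0 : Num.sqrt (0 : R) = 0 by exact: sqrtr0.
have sqrt1 (t : R) : 0 <= t <= 1 -> 0 <= Num.sqrt t <= 1.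
  by move=> /andP[t0 t1]; rewrite sqrtr_ge0 -sqrtr1 ler_wsqrtr.
have xcone := @signed_real_cone d.+1 _ (@sqrt_continuous R) sqrt0.
have [X [[sX nX] pX gX]] := graded_lift dm xcone
  (fun p => @signed_le1 d.+1 _ p sqrt1)
  (fun s l g hg => signed_shift Num.sqrt s l dm hg).
pose w (t : R) : R[i] := (root4 t)%:C%C.
have cw : continuous w.
  move=> t; apply: (@continuous_comp _ _ _ (@root4 R) (real_complex R)).
    exact: root4_continuous.
  exact: real_complex_continuous.
have w0 t : t <= 0 -> w t = 0 by move=> t0; rewrite /w root4_neg.
pose E := fc D w; have wE : is_fc D w E by exact: fcP.
have sE : star E = E.
  apply: (is_fc_unique hD _ wE).
  have [sD _] := hD; apply: is_fc_ext (is_fc_star sD wE) => t _; exact: realcJ.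
have nE : nrm E <= 1.
  apply: (is_fc_norm hD wE) => t _.
  rewrite /w normc_def /= expr0n addr0 sqrtr_sqr lecR.
  by rewrite ger0_norm ?root4_ge0 ?root4_le1.
have pE := fc_rho hD (dyadic_coord_cone d) (dyadic_coord_le1 d) pD cw wE.
exists (E * X * E); split; first split.
- split; first by rewrite !starMr sE sX mulrA.
  apply: le_lt_trans nX; apply: le_trans (nrmM _ _) _.
  rewrite -[leRHS]mulr1; apply: ler_pM; rewrite ?nrm_ge0//.
  apply: le_trans (nrmM _ _) _.
  by rewrite -[leRHS]mul1r; apply: ler_wpM2r; rewrite ?nrm_ge0.
- move=> l hl; have := hl; rewrite dyadicS => /andP[hl' el].
  (* [dyadic d.+1] is the kernel of the character. *)
  have aD : alpha l D = D.
    by rewrite gD// /dyadic_sign hl' (negbTE el) expr0 scale1r.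
  have aE : alpha l E = E.
    by have := fc_act l wE; rewrite aD => h; exact: is_fc_unique hD h wE.
  rewrite !(star_homM (act_hom alpha l)) aE gX//.
  by rewrite -cscalerAr -cscalerAl.
- move=> l hl; rewrite !(star_homM (act_hom alpha l)).
  rewrite !mulrA -(mulrA _ E) (positive_part_orth _ cw cw w0 w0 wE wE hl).
    by rewrite mulr0 !mul0r.
  by split.
- rewrite !(star_homM pi_hom) pE pX.
  have xC := real_cone_cone xcone; have /ucone_cone[xD _] := xC.
  have wD := real_cone_comp (dyadic_coord_cone d) cw.
  rewrite -(unital_ext_cone rho xC) -unital_extM// -unital_extM//; last exact: uconeM.
  rewrite -(unital_ext_cone rho (real_cone_cone (dyadic_coord_cone d.+1))).
  congr unital_ext; apply/funext => -[s l]; rewrite /w /dyadic_coord /=.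
  rewrite -!(rmorphM (real_complex R)); congr (_%:C%C).
  have [hl|hl] := boolP (dyadic d.+1 l); last first.
    by rewrite /dyadic_sign (negbTE hl) !mul0r mulr0 mul0r.
  have -> : dyadic_sign R d l = 1.
    move: hl; rewrite dyadicS /dyadic_sign => /andP[-> /negbTE ->].
    by rewrite expr0.
  have := root4_sqr (set_val_unit s); rewrite mul1r.
  set a := root4 _; set b := Num.sqrt _ => ab.
  by rewrite -[X in _ = _ * X]ab; ring.
Qed.

Lemma rho_sum (I : finType) (F : I -> cone_space R k -> R[i]) :
  (forall i, cone_algebra (F i)) ->
  rho (fun p => \sum_i F i p) = \sum_i rho (F i).
Proof.
move=> hF; have hD i := proj1 (iffLR (ucone_cone (F i)) (hF i)).
have H (s : seq I) : unital_cone_algebra (fun p => \sum_(i <- s) F i p) /\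
    unital_ext rho (fun p => \sum_(i <- s) F i p) = \sum_(i <- s) rho (F i).
  elim: s => [|i s [IH1 IH2]].
    rewrite (_ : (fun p => _) = fun=> 0); last by apply/funext => p; rewrite big_nil.
    by rewrite big_nil unital_ext_cst// scale0r; split=> //; exact: ucone_cst.
  rewrite (_ : (fun p => _) = fun p => 1 * F i p + \sum_(j <- s) F j p); last first.
    by apply/funext => p; rewrite big_cons mul1r.
  split; first exact: ucone_lin.
  by rewrite unital_ext_lin// IH2 big_cons scale1r unital_ext_cone.
have [sD sE] := H (index_enum I).
rewrite -sE unital_ext_cone//; apply/ucone_cone; split=> //.
rewrite big1// => i _; have := iffLR (ucone_cone (F i)) (hF i); tauto.
Qed.

(** For d = m - 1 the subgroup [dyadic d.+1] is trivial, so the positive part of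
    the lift D is orthogonal to all its other translates, and
    f |-> sum_l alpha_l (f(D, l)) is an equivariant homomorphism.  It lifts rho
    because D lifts a function that is s on l = 0 and nonpositive for every
    other l, so that f(D, l) lifts f(-, l) moved to l = 0; only the value at
    t (x) 1 is recorded. *)
Lemma cone_lift : exists rho' : (cone_space R k -> R[i]) -> A,
  equivariant_cone_hom alpha rho' /\ pi (rho' (@cone_t R k)) = rho (@cone_t R k).
Proof.
have pm : (m.-1 < m)%N by rewrite prednK.
have [D [eD pD]] := dyadic_lift pm; have [hD gD oD] := eD.
(* F f l extends f(-, l) from [0, 1] to the line, by 0 on the negative side. *)
pose F (f : cone_space R k -> R[i]) (l : G) (t : R) := f (unit_clamp t, l).
have cF f l : cone_algebra f -> continuous (F f l).
  move=> hf t; apply: (@continuous_comp _ _ _ (@unit_clamp R) (fun s => f (s, l))).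
    exact: unit_clamp_continuous.
  exact: (hf l).1.
have F0 f l t : cone_algebra f -> t <= 0 -> F f l t = 0.
  by move=> hf t0; rewrite /F unit_clamp_neg// (hf l).2// set_val_cone_origin.
have Ffc f l : cone_algebra f -> is_fc D (F f l) (fc D (F f l)).
  by move=> hf; apply: fcP => //; exact: cF.
have offdiag f g l l' : cone_algebra f -> cone_algebra g -> l != l' ->
    alpha l (fc D (F f l)) * alpha l' (fc D (F g l')) = 0.
  move=> hf hg ll.
  have -> : l' = l + (l' - l) by rewrite addrC subrK.
  rewrite actD -(star_homM (act_hom alpha l)).
  rewrite [_ * _](positive_part_orth eD (cF _ l hf) (cF _ _ hg)
    (fun t => F0 _ _ _ hf) (fun t => F0 _ _ _ hg) (Ffc _ _ hf) (Ffc _ _ hg)).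
    exact: star_hom0 (act_hom alpha l).
  rewrite prednK//; apply/negP => /(dyadic_top m0)/eqP; rewrite subr_eq0 eq_sym.
  exact/negP.
exists (fun f => \sum_l alpha l (fc D (F f l))); split; first split; first split.
- move=> c f g hf hg; rewrite scaler_sumr -big_split; apply: eq_bigr => l _ /=.
  rewrite -(star_homZ (act_hom alpha l)) -(star_homD (act_hom alpha l)); congr (alpha l _).
  by apply: fc_eq => //; apply: is_fc_lin; exact: Ffc.
- move=> f g hf hg; rewrite mulr_suml; apply: eq_bigr => l _.
  rewrite mulr_sumr (bigD1 l)//= [X in _ + X]big1 ?addr0; last first.
    by move=> l' ll; apply: offdiag; rewrite // eq_sym.
  rewrite -(star_homM (act_hom alpha l)); congr (alpha l _).
  by apply: fc_eq => //; apply: is_fcM; try exact: cF; exact: Ffc.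
- move=> f hf; rewrite star_sum; apply: eq_bigr => l _.
  rewrite -(star_homJ (act_hom alpha l)); congr (alpha l _).
  by apply: fc_eq => //; apply: is_fc_star; [case: hD|exact: Ffc].
- move=> g f hf; rewrite (star_hom_sum (act_hom alpha g)) (reindex_inj (addrI g)) /=.
  apply: eq_bigr => l _; rewrite -actD; congr (alpha _ (fc D _)).
  by apply/funext => t; rewrite /F /cone_translate /= addrC addKr.
have tC : cone_algebra (@cone_t R k).
  move=> l; split=> [|s s0]; last by rewrite /cone_t s0.
  apply: (@continuous_comp_unit _ _ (fun t => t%:C%C)).
  exact: real_complex_continuous.
pose e (p : cone_space R k) : R := if p.2 == 0 then set_val p.1 else 0.
have eE p : (e p)%:C%C = F (@cone_t R k) 0 (dyadic_coord m.-1 p).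
  rewrite /F /cone_t /= set_val_unit_clamp /e /dyadic_coord; congr (_%:C%C).
  have [->|l0] := eqVneq p.2 0.
    by rewrite dyadic_sign0 mul1r clamp_id// set_val_unit.
  have /andP[s0 _] := set_val_unit p.1.
  rewrite clamp_neg// /dyadic_sign; case: ifP => hl; last by rewrite mul0r.
  have -> : dyadic_odd m.-1 p.2.
    apply/idPn => ol; move/eqP: l0; apply; apply: (dyadic_top m0).
    by rewrite -[X in dyadic X](prednK m0) dyadicS hl.
  by rewrite expr1 mulN1r oppr_le0.
have eC : cone_algebra (fun p => (e p)%:C%C).
  apply/ucone_cone; split; last by rewrite /e eqxx /= set_val_cone_origin.
  rewrite (_ : (fun p => _) = (fun p => F (@cone_t R k) 0 (dyadic_coord m.-1 p))).
    by apply: real_cone_comp; [exact: dyadic_coord_cone|exact: cF].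
  by apply/funext => p; exact: eE.
have pie : pi (fc D (F (@cone_t R k) 0)) = rho (fun p => (e p)%:C%C).
  rewrite (fc_rho hD (dyadic_coord_cone _) (dyadic_coord_le1 _) pD (cF _ 0 tC) (Ffc _ 0 tC)).
  rewrite -(unital_ext_cone rho eC); congr unital_ext.
  by apply/funext => p; rewrite eE.
have trC l : cone_algebra (cone_translate l (fun p => (e p)%:C%C)).
  by move=> l'; exact: (eC (l' - l)).
rewrite (star_hom_sum pi_hom).
(* The generator t (x) 1 is the sum of the translates of the function e,
   which is s on l = 0 and 0 elsewhere. *)
have ct : @cone_t R k = (fun p => \sum_l cone_translate l (fun p => (e p)%:C%C) p).
  apply/funext => -[s l]; rewrite (bigD1 l)//= [X in _ + X]big1.
    by rewrite addr0 /cone_translate /e /= subrr eqxx.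
  move=> l' ll; rewrite /cone_translate /e /= subr_eq0 eq_sym (negbTE ll) //.
rewrite [in RHS]ct rho_sum//; apply: eq_bigr => l _.
have -> : F (@cone_t R k) l = F (@cone_t R k) 0 by [].
rewrite pi_act pie; exact: esym (proj2 rho_equiv l _ eC).
Qed.

End EquivariantLifting.

(** * Invertibility by Neumann series *)

Section Invertibility.
Variables (R : realType) (B : cstarAlgType R).
Implicit Types (b c z : B).

Lemma nrm_expr_le z n : nrm (z ^+ n) <= nrm z ^+ n.
Proof.
elim: n => [|n IH]; first by rewrite !expr0 nrm1.
rewrite !exprS; apply: le_trans (nrmM _ _) _.
by apply: ler_wpM2l; rewrite ?nrm_ge0.
Qed.

Lemma neumann_invertible z : nrm (1 - z) < 1 -> invertible z.
Proof.
set r := 1 - z => r1; have r0 := nrm_ge0 r.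
have zr : z = 1 - r by rewrite /r subKr.
pose a n := \sum_(i < n) r ^+ i.
have aS n : a n.+1 - a n = r ^+ n by rewrite /a big_ord_recr addrAC subrr add0r.
have : cvg (a @ \oo).
  apply: (@geometric_cvg _ _ _ (nrm r)); first by rewrite r0.
  by move=> n; rewrite aS nrm_expr_le.
move=> /cvg_ex[y ay].
have za n : z * a n = 1 - r ^+ n /\ a n * z = 1 - r ^+ n.
  elim: n => [|n [IH1 IH2]].
    by rewrite /a big_ord0 mulr0 mul0r expr0 subrr.
  have -> : a n.+1 = a n + r ^+ n by rewrite -aS addrC subrK.
  rewrite mulrDr mulrDl IH1 IH2 zr mulrBl mulrBr mul1r mulr1 -exprS -exprSr.
  by rewrite addrA subrK.
have rn : (1 - r ^+ n : B) @[n --> \oo] --> (1 : B).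
  apply/cvgrPdist_le => e e0; have [s s0 eE] := norm_realE e.
  have {}eE : e = s%:C%C by rewrite -eE gtr0_norm.
  have s1 : 0 < s by rewrite -ltcR -eE.
  have : nrm r ^+ n @[n --> \oo] --> 0 by apply: cvg_expr; rewrite ger0_norm.
  move=> /cvgrPdist_le /(_ _ s1); apply: filterS => n.
  rewrite sub0r normrN ger0_norm ?exprn_ge0// => h.
  rewrite subKr eE -nrm_le; exact: le_trans (nrm_expr_le _ _) h.
exists y; split.
  apply: (@seq_lim_unique _ _ (fun n => z * a n)).
    exact: cvg_cmul (cvg_cst z) ay.
  by under eq_fun do rewrite (za _).1.
apply: (@seq_lim_unique _ _ (fun n => a n * z)).
  exact: cvg_cmul ay (cvg_cst z).
by under eq_fun do rewrite (za _).2.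
Qed.

(** b c and c b are invertible, so b has a right and a left inverse. *)
Lemma almost_inverse_invertible b c :
  nrm (1 - b * c) < 1 -> nrm (1 - c * b) < 1 -> invertible b.
Proof.
move=> /neumann_invertible[y [bcy _]] /neumann_invertible[z [_ zcb]].
have e : z * c = c * y.
  by rewrite -[z * c]mulr1 -bcy !mulrA -(mulrA z) zcb mul1r.
exists (c * y); split; first by rewrite mulrA.
by rewrite -e -mulrA.
Qed.

End Invertibility.

(** * Spreading from a fiber to its neighbours *)

Section FiberNeighbourhoods.
Variables (R : realType) (X : topologicalType) (A : cstarAlgType R).

Section CX.
Variable phi : CX_structure X A.
Local Notation pi y := (@fiber_pi R X A phi y).

Lemma fiber_quotient_hom y : @star_hom R A (fiber phi y) (pi y).
Proof.
split.
- by move=> c a b; rewrite fiber_piD -fiber_scaleE.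
- by split=> [//|a b]; rewrite -fiber_mulE.
- by move=> a; rewrite -fiber_starE.
Qed.

Lemma fiber_cx y (v : X -> R[i]) a : continuous v ->
  pi y (phi v * a) = v y *: pi y a.
Proof.
move=> cv; rewrite -(star_homZ (fiber_quotient_hom y)); apply/fiber_piP.
rewrite -[X in _ - _ *: X]mul1r cscalerAl -mulrBl.
have [_ _ _ JM] := fiber_ideal_closed phi y; apply (JM a).
have c1 : continuous (fun _ : X => 1 : R[i]) by move=> z; exact: cvg_cst.
have -> : phi v - v y *: (1 : A) = phi (fun z => (- v y) * 1 + v z).
  by rewrite (cx_lin phi _ c1 cv) cx1 scaleNr addrC.
apply: fiber_ideal_cx; last by rewrite mulr1 addNr.
by move=> z; apply: cvgD; [exact: cvg_cst|exact: cv].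
Qed.

(** If the image of a at x vanishes, multiplying a by a suitable v with
    v(x) = 1 makes it small in norm.  In the fiber at y the function v is the
    scalar v(y), which is at least 1/2 in modulus for y near x and can be
    divided out. *)
Lemma fiber_norm_upper x a (e : R) : 0 < e -> pi x a = 0 ->
  \forall y \near x, nrm (pi y a) < e.
Proof.
move=> e0; rewrite -(@fiber_pi0 R X A phi x) => /fiber_piP; rewrite subr0 => Ja.
have e4 : 0 < (e / 4)%:C%C by rewrite (ltcR 0) divr_gt0.
have [v [cv v1 _] va] := fiber_approx_unit Ja e4.
have h2 : 0 < 2^-1 :> R[i] by rewrite invr_gt0 ltr0n.
have /cvgrPdist_lt /(_ _ h2) := cv x.
apply: filterS => y; rewrite v1 => vy.
have vy2 : 2^-1 <= `|v y|.
  have := ler_distD (v y) 1 0; rewrite !subr0 normr1 => h.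
  have e1 : 1 - 2^-1 = 2^-1 :> R[i] by field.
  rewrite -e1 lerBlDl; apply: le_trans h _; rewrite lerD2r; exact: ltW.
have v0 : v y != 0 by rewrite -normr_gt0; exact: lt_le_trans vy2.
have -> : pi y a = (v y)^-1 *: pi y (phi v * a).
  by rewrite fiber_cx// scalerA mulVf// scale1r.
apply: le_lt_trans (@nrmZ_le _ _ _ 2 _ _) _.
  rewrite normfV (rmorph_nat (real_complex R)) -[leRHS]invrK lef_pV2//.
    by rewrite posrE normr_gt0.
have : nrm (pi y (phi v * a)) <= e / 4.
  apply: le_trans (star_hom_nrm (fiber_quotient_hom y) _) _.
  by rewrite nrm_le.
lra.
Qed.

(** If c represents the inverse at x, then 1 - b c and 1 - c b vanish at x, hence
    have norm < 1 at all nearby points. *)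
Lemma invertible_spreads x b : @invertible R (fiber phi x) (pi x b) ->
  \forall y \near x, @invertible R (fiber phi y) (pi y b).
Proof.
move=> [u [bu ub]]; pose c := fiber_repr u.
have piM y := star_homM (fiber_quotient_hom y).
have pi1 y := star_hom1 (fiber_quotient_hom y).
have piB y := star_homB (fiber_quotient_hom y).
have h1 : pi x (1 - b * c) = 0 by rewrite piB piM pi1 fiber_reprK bu subrr.
have h2 : pi x (1 - c * b) = 0 by rewrite piB piM pi1 fiber_reprK ub subrr.
near=> y.
have n1 : nrm (pi y (1 - b * c)) < 1 by near: y; exact: fiber_norm_upper.
have n2 : nrm (pi y (1 - c * b)) < 1 by near: y; exact: fiber_norm_upper.
by apply: (@almost_inverse_invertible _ _ _ (pi y c)); rewrite -piM -pi1 -piB.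
Unshelve. all: by end_near. Qed.

End CX.
End FiberNeighbourhoods.

(** * Openness of the dimension bounds *)

Section OpenWitness.
Variables (R : realType) (m : nat) (m0 : (0 < m)%N).
Variables (X : topologicalType) (A : cstarAlgType R).
Variable E : equivariant_CX_structure 'Z_(2 ^ m)%N X A.

Lemma fiber_cone_lift x rho : equivariant_cone_hom (fiber_action E x) rho ->
  exists rho', equivariant_cone_hom (cx_act E) rho' /\
    fiber_pi E x (rho' (@cone_t R (2 ^ m))) = rho (@cone_t R (2 ^ m)).
Proof.
move=> hrho; apply: (@cone_lift R m m0 A (cx_act E) (fiber E x) (fiber_action E x)).
- exact: fiber_pi_hom.
- by move=> g a; rewrite /= fiber_actE.
- by move=> u e e0; exact: fiber_norm_lt.
- exact: hrho.
Qed.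

Lemma fiber_push y rho : equivariant_cone_hom (cx_act E) rho ->
  equivariant_cone_hom (fiber_action E y) (fun f => fiber_pi E y (rho f)).
Proof.
move=> [[rl rM rJ] re]; have [pl [p1 pM] pJ] := fiber_pi_hom E y.
split; first split.
- by move=> c f g hf hg; rewrite rl// pl.
- by move=> f g hf hg; rewrite rM// pM.
- by move=> f hf; rewrite rJ// pJ.
- by move=> g f hf; rewrite re// /= fiber_actE.
Qed.

(** The lifts are homomorphisms into the whole algebra, so they can be pushed to
    any fiber. *)
Lemma wlt_witness_spreads x n : wlt_witness (fiber_action E x) n ->
  \forall y \near x, wlt_witness (fiber_action E y) n.
Proof.
move=> [rho [hrho inv]].
have /choice[rho' hrho'] : forall j, exists rho' : (cone_space R (2 ^ m) -> R[i]) -> A,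
    equivariant_cone_hom (cx_act E) rho' /\
    fiber_pi E x (rho' (@cone_t R (2 ^ m))) = rho j (@cone_t R (2 ^ m)).
  by move=> j; exact: fiber_cone_lift.
have hsum y : fiber_pi E y (\sum_j rho' j (@cone_t R (2 ^ m))) =
    \sum_j fiber_pi E y (rho' j (@cone_t R (2 ^ m))).
  exact: (@star_hom_sum R A (fiber E y) _ (fiber_pi_hom E y) _ (fun j => rho' j _)).
have : invertible (fiber_pi E x (\sum_j rho' j (@cone_t R (2 ^ m))) : fiber E x).
  by rewrite hsum (eq_bigr _ (fun j _ => (hrho' j).2)).
move=> /invertible_spreads; apply: filterS => y hy.
exists (fun j f => fiber_pi E y (rho' j f)); split; last by rewrite -hsum.
by move=> j; apply: fiber_push; exact: (hrho' j).1.
Qed.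

(** The possible values of the dimension are discrete, so the infimum is below
    n.+1 only if it is attained. *)
Lemma dim_WLT_le (B : cstarAlgType R) k (beta : cstar_action 'Z_k B) n :
  (dim_WLT beta <= n%:R%:E)%E <-> exists2 i, (i <= n)%N & wlt_witness beta i.
Proof.
split=> [h|[i ni wi]]; last first.
  apply: (@le_trans _ _ (i%:R%:E)); last by rewrite lee_fin ler_nat.
  by apply: ereal_inf_lbound; exists i.
apply: contrapT => hn; suff : ((n.+1)%:R%:E <= dim_WLT beta)%E.
  by move=> /le_trans/(_ h); rewrite lee_fin ler_nat ltnn.
apply: le_ereal_inf_tmp => _ [i wi <-]; rewrite lee_fin ler_nat ltnNge.
by apply/negP => ni; apply: hn; exists i.
Qed.

End OpenWitness.

Theorem theorem3p17 (R : realType) (m : nat) (hm : (0 < m)%N)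
    (X : topologicalType) (hX : compact [set: X]) (hX2 : hausdorff_space X)
    (A : cstarAlgType R) (E : equivariant_CX_structure 'Z_(2 ^ m)%N X A) :
  forall n : nat, open [set x : X | (dim_WLT (fiber_action E x) <= n%:R%:E)%E].
Proof.
move=> n; rewrite openE => x /dim_WLT_le[i ni wi].
have := wlt_witness_spreads hm wi; apply: filterS => y wy.
by apply/dim_WLT_le; exists i.
Qed.
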